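(* Let $X$ be a regular Fréchet sequence algebra for the Cauchy product and let $B_w$ be a bounded weighted backward shift on $X$. The following assertions are equivalent. (i) $B_w$ is hypercyclic, i.e. $HC(B_w)\ne\varnothing$. (ii) $B_w$ supports a hypercyclic algebra which is dense in $X$ and not finitely generated.
   Context: $\mathbb N=\{1,2,\dots\}$, $\mathbb N_0=\mathbb N\cup\{0\}$, $\omega=\mathbb C^{\mathbb N_0}$, and $e_n\in\omega$ is the sequence with $1$ in position $n$ and $0$ elsewhere. A Fréchet sequence algebra is a subspace $X$ of $\omega$ which is a Fréchet space (complete metrizable) for the topology induced by a non-decreasing sequence of seminorms $(\|\cdot\|_q)_{q\ge1}$, such that convergence in $X$ implies coordinatewise convergence, endowed with a product satisfying $\|x\cdot y\|_q\le\|x\|_q\|y\|_q$ for all $x,y\in X$, $q\ge1$. The Cauchy (convolution) product is $(x\cdot y)_n=\sum_{j=0}^nx_jy_{n-j}$. A Fréchet sequence algebra $X$ for the Cauchy product is called regular if: (a) $X$ admits a continuous norm (a norm on $X$ bounded by $C\|\cdot\|_q$ for some $q\ge1$, $C>0$); (b) $(e_n)_{n\ge0}$ is a Schauder basis of $X$; (c) for any $r\ge1$ there exist $q\ge1$ and $C>0$ such that $\|e_n\|_r\cdot\|e_k\|_r\le C\|e_{n+k}\|_q$ for all $n,k\ge0$. For a sequence $w=(w_n)_{n\ge1}$ of nonzero complex numbers, $B_w(x_0,x_1,\dots)=(w_1x_1,w_2x_2,\dots)$; ''bounded on $X$'' means that $B_w$ is a continuous linear operator from $X$ to $X$. $HC(T)$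 is the set of $x\in X$ whose orbit $\{x,Tx,T^2x,\dots\}$ is dense in $X$. A hypercyclic algebra for $T$ is a subalgebra of $X$, different from $\{0\}$ and not required to be unital, contained in $HC(T)\cup\{0\}$; finitely generated means generated, as a (non-unital) algebra, by finitely many elements. *)

(* Defs.v *)
From HB Require Import structures.
From mathcomp Require Import all_boot all_order all_algebra.
From mathcomp Require Import all_classical all_reals all_analysis.
From mathcomp.real_closed Require Export complex.
Import Order.TTheory GRing.Theory Num.Theory.
Export numFieldNormedType.Exports.

Set Implicit Arguments.
Unset Strict Implicit.
Unset Printing Implicit Defensive.

Local Open Scope classical_set_scope.
Local Open Scope ring_scope.

Local Notation normc := ComplexField.Normc.normc.

(* [R[i]^o] is [R[i]] seen as a vector space over itself, so that sequences
   form an [R[i]]-vector space (pointwise operations). The product [*] of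
   functions is pointwise as well: the Cauchy product is [cauchy_prod]. *)
Definition omega (R : realType) : lmodType R[i] := (nat -> R[i]^o)%type.

Definition unit_seq (R : realType) (n : nat) : omega R :=
  fun k => (k == n)%:R.

Definition cauchy_prod (R : realType) (x y : omega R) : omega R :=
  fun n => \sum_(j < n.+1) x j * y (n - j)%N.

(* [w 0] plays no role. *)
Definition weighted_shift (R : realType) (w : nat -> R[i]) (x : omega R) :
  omega R := fun n => w n.+1 * x n.+1.

(* A subspace of omega closed under the Cauchy product, with a non-decreasing
   sequence of submultiplicative seminorms. The seminorms are functions on all
   of omega of which only the values on the subspace matter; they are indexed
   from 0 instead of 1. [ComplexField.Normc.normc] is the modulus with values
   in [R]. *)
Structure seqAlgebra (R : realType) := SeqAlgebra {
  seqalg_pred : submodClosed (omega R);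
  seminorm : nat -> omega R -> R;
  seminorm_ge0 : forall q x, x \in seqalg_pred -> 0 <= seminorm q x;
  seminormD : forall q x y, x \in seqalg_pred -> y \in seqalg_pred ->
    seminorm q (x + y) <= seminorm q x + seminorm q y;
  seminormZ : forall q (a : R[i]) x, x \in seqalg_pred ->
    seminorm q (a *: x) = normc a * seminorm q x;
  seminorm_nondecreasing : forall q r x, (q <= r)%N -> x \in seqalg_pred ->
    seminorm q x <= seminorm r x;
  cauchy_prod_closed : forall x y, x \in seqalg_pred -> y \in seqalg_pred ->
    cauchy_prod x y \in seqalg_pred;
  seminormM : forall q x y, x \in seqalg_pred -> y \in seqalg_pred ->
    seminorm q (cauchy_prod x y) <= seminorm q x * seminorm q y }.

Record seqalg_sort (R : realType) (X : seqAlgebra R) : Type := SeqAlgElt {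
  seq_of :> omega R;
  seq_ofP : seq_of \in seqalg_pred X }.
Coercion seqalg_sort : seqAlgebra >-> Sortclass.

Section SeqAlgebraInstances.
Context (R : realType) (X : seqAlgebra R).

HB.instance Definition _ := [isSub of seqalg_sort X for @seq_of R X].
HB.instance Definition _ := [Choice of seqalg_sort X by <:].
HB.instance Definition _ :=
  [SubChoice_isSubLmodule of seqalg_sort X by <:].

Lemma seq_of_is_linear : linear (@seq_of R X).
Proof. exact: (linearP (val : X -> omega R)). Qed.

HB.instance Definition _ :=
  GRing.isLinear.Build R[i] X (omega R) *:%R (@seq_of R X) seq_of_is_linear.

Definition seqalg_mul (x y : X) : X :=
  SeqAlgElt (cauchy_prod_closed (seq_ofP x) (seq_ofP y)).

Definition sn (q : nat) (x : X) : R := seminorm X q x.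

Lemma snN q x : sn q (- x) = sn q x.
Proof.
rewrite /sn -scaleN1r linearZ /= seminormZ ?(seq_ofP x)//.
by rewrite normcN ComplexField.Normc.normc1 mul1r.
Qed.

Lemma snB_triangle q (x y z : X) : sn q (x - z) <= sn q (x - y) + sn q (y - z).
Proof.
rewrite (_ : x - z = (x - y) + (y - z)); last by rewrite addrA subrK.
exact: seminormD (seq_ofP _) (seq_ofP _).
Qed.

Lemma sn0 q : sn q 0 = 0.
Proof.
rewrite /sn -(scale0r (0 : X)) linearZ /= seminormZ ?(seq_ofP (0 : X))//.
by rewrite ComplexField.Normc.normc0 mul0r.
Qed.

(* The uniformity, hence the topology, induced by the seminorms. Finite
   intersections of seminorm balls are not needed since the seminorms are
   non-decreasing. *)
Definition seqalg_ent : set_system (X * X) :=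
  [set A | exists q : nat, exists2 e : R, 0 < e &
    [set xy | sn q (xy.1 - xy.2) < e] `<=` A].

Lemma seqalg_ent_filter : Filter seqalg_ent.
Proof.
split.
- by exists 0%N, 1.
- move=> A B [q [e e0 qA]] [r [d d0 rB]].
  exists (maxn q r), (Num.min e d); first by rewrite lt_min e0.
  move=> xy /=; rewrite lt_min => /andP[xye xyd]; split.
  + by apply: qA; apply: le_lt_trans xye;
      apply: seminorm_nondecreasing; rewrite ?leq_maxl ?seq_ofP.
  + by apply: rB; apply: le_lt_trans xyd;
      apply: seminorm_nondecreasing; rewrite ?leq_maxr ?seq_ofP.
- move=> A B AB [q [e e0 qA]]; exists q, e => //; exact: subset_trans qA AB.
Qed.

Local Open Scope relation_scope.

Lemma seqalg_ent_diagonal A : seqalg_ent A -> diagonal `<=` A.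
Proof.
move=> [q [e e0 qA]] [x y] xy; have {xy}-> : x = y by [].
by apply: qA; rewrite /= subrr sn0.
Qed.

Lemma seqalg_ent_inv A : seqalg_ent A -> seqalg_ent A^-1.
Proof.
move=> [q [e e0 qA]]; exists q, e => // -[x y] /= xy.
by apply: qA; rewrite /= -snN opprB.
Qed.

Lemma seqalg_ent_split A :
  seqalg_ent A -> exists2 B, seqalg_ent B & B \; B `<=` A.
Proof.
move=> [q [e e0 qA]]; exists [set xy | sn q (xy.1 - xy.2) < e / 2].
  by exists q, (e / 2); rewrite ?divr_gt0.
move=> [x z] [y /= xy yz]; apply: qA => /=.
by rewrite (splitr e) (le_lt_trans (snB_triangle q x y z))// ltrD.
Qed.

HB.instance Definition _ := isUniform.Build (seqalg_sort X)
  seqalg_ent_filter seqalg_ent_diagonal seqalg_ent_inv seqalg_ent_split.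

End SeqAlgebraInstances.

Section Properties.
Context (R : realType) (X : seqAlgebra R).

(* The countable family of seminorms gives the uniformity a countable base, so
   metrizability amounts to Hausdorffness, and completeness for Cauchy filters
   to completeness for Cauchy sequences. *)
Definition is_frechet_seq_algebra : Prop :=
  [/\ hausdorff_space X,
      (forall F : set_system X, ProperFilter F -> cauchy F ->
         exists x : X, F --> x) &
      (forall (u : nat -> X) (x : X), u @ \oo --> x ->
         forall k, (fun n => seq_of (u n) k) @ \oo --> (seq_of x k : R[i]^o))].

Definition is_norm (N : X -> R) : Prop :=
  [/\ (forall x, 0 <= N x),
      (forall x, N x = 0 -> x = 0),
      (forall x y, N (x + y) <= N x + N y) &
      (forall (a : R[i]) x, N (a *: x) = normc a * N x)].

Definition admits_continuous_norm : Prop :=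
  exists2 N : X -> R, is_norm N &
    exists q : nat, exists2 c : R, 0 < c & forall x, N x <= c * sn q x.

Definition is_schauder_basis (e : nat -> X) : Prop :=
  forall x : X, exists! a : nat -> R[i],
    series (fun n => a n *: e n) @ \oo --> x.

Definition is_regular : Prop :=
  [/\ admits_continuous_norm,
      (exists2 e : nat -> X,
         (forall n, e n = unit_seq R n :> omega R) & is_schauder_basis e) &
      (forall r : nat, exists q : nat, exists2 c : R, 0 < c &
         forall n k, seminorm X r (unit_seq R n) * seminorm X r (unit_seq R k)
           <= c * seminorm X q (unit_seq R (n + k)))].

(* Subalgebras are not required to be unital. *)
Definition is_subalgebra (A : set X) : Prop :=
  [/\ A 0,
      (forall x y, A x -> A y -> A (x + y)),
      (forall (a : R[i]) x, A x -> A (a *: x)) &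
      (forall x y, A x -> A y -> A (seqalg_mul x y))].

Definition finitely_generated (A : set X) : Prop :=
  exists2 S : set X, finite_set S & A = smallest is_subalgebra S.

Definition HC (T : X -> X) : set X :=
  [set x | dense (range (fun n : nat => iter n T x))].

Definition is_hypercyclic_algebra (T : X -> X) (A : set X) : Prop :=
  [/\ is_subalgebra A, A <> [set 0] & A `<=` HC T `|` [set 0]].

(* [T] is the weighted backward shift [B_w], acting boundedly on [X]. *)
Definition is_bounded_weighted_shift (w : nat -> R[i]) (T : {linear X -> X}) :
    Prop :=
  (forall x, T x = weighted_shift w x :> omega R) /\ continuous T.

End Properties.

(* Main.v *)
(* If [B_w] has a hypercyclic vector, then [e_n / (w_1 ... w_n)] is small in any
   given seminorm for infinitely many [n]. Regularity and the continuity of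
   [B_w] make this robust under changes of the seminorm, under bounded
   translations of [n], and under multiplication by bounded powers of boundedly
   many of the weights near [n].

   Fix a monomial [u^b] in finitely many variables, and integers [a_i > 0].
   Every finitely supported [x] can be perturbed into
     [u_i = x_i + t^(a_i) e_(a_i s) (+ D for one i with b_i > 0)]
   with [t e_s] small, [|t|^M |w_1 ... w_n|] small, where [M = sum a_i b_i] and
   [n = s M], and with [D] a small combination of basis vectors of index
   slightly less than [a_i s]. For [N] slightly less than [n], the iterate
   [B_w^N] kills all the monomials of weighted degree less than [M], while
   [B_w^N u^b] only sees the terms of [u^b] linear in [D], which may be chosen to
   hit any target, and the small term [t^M B_w^N e_n].

   A Baire argument gives a dense sequence [z] such that this happens for all
   [b], all targets and all [a_i = B^i]. For [B] large these weights separate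
   the monomials of a given polynomial, so that one of them dominates and each
   nonzero polynomial in [z] without constant term is hypercyclic. In particular
   the [z_i] are algebraically independent, hence generate an algebra which is
   not finitely generated. *)
Require Import Defs.
From mathcomp Require Import all_boot all_order all_algebra.
From mathcomp Require Import all_classical all_reals all_analysis.
From mathcomp Require Import zify ring lra.
From HB Require Import structures.
Import Order.TTheory GRing.Theory Num.Theory.

Set Implicit Arguments.
Unset Strict Implicit.
Unset Printing Implicit Defensive.

Local Open Scope classical_set_scope.
Local Open Scope ring_scope.

Local Notation normc := ComplexField.Normc.normc.

(** * Stability of small seminorms of basis vectors *)

Section Growth.
(** In the application [E q n] is a seminorm of [e_n] and [A n] is the modulus of w_1 ... w_n. Then
    [E_supmul] is condition (c) of regularity, [E_shift] the continuity of the shift at [e_(n+1)],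
    and [E_small] what hypercyclicity gives. *)
Context (R : realType) (E : nat -> nat -> R) (A : nat -> R).
Hypothesis E_gt0 : forall q n, 0 < E q n.
Hypothesis A_gt0 : forall n, 0 < A n.
Hypothesis E_mono : forall q r n, (q <= r)%N -> E q n <= E r n.
Hypothesis E_submul : forall q n k, E q (n + k)%N <= E q n * E q k.
Hypothesis E_supmul : forall r, exists q : nat, exists2 c : R, 0 < c &
  forall n k, E r n * E r k <= c * E q (n + k)%N.
Hypothesis E_shift : forall r, exists q : nat, exists2 c : R, 0 < c &
  forall n, A n.+1 * E r n <= c * (A n * E q n.+1).
Hypothesis E_small : forall q (eta : R) n0, 0 < eta ->
  exists2 n, (n0 <= n)%N & E q n < eta * A n.

(** Divide [E_supmul] by [E r i]; the sum bounds all the finitely many inverses at once. *)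
Lemma E_le_translate J r : exists q : nat, exists2 c : R, 0 < c &
  forall n i, (i <= J)%N -> E r n <= c * E q (n + i)%N.
Proof.
have [q [c c0 cP]] := E_supmul r.
exists q; exists (c * \sum_(i < J.+1) (E r i)^-1).
  rewrite mulr_gt0// big_ord_recl ltr_wpDr ?invr_gt0// sumr_ge0// => i _.
  by rewrite invr_ge0 ltW.
move=> n i iJ.
have h : (E r i)^-1 <= \sum_(i < J.+1) (E r i)^-1.
  have iJ' : (i < J.+1)%N by [].
  rewrite (bigD1 (Ordinal iJ'))//= lerDl sumr_ge0// => k _.
  by rewrite invr_ge0 ltW.
rewrite mulrAC; apply: (@le_trans _ _ (c * E q (n + i)%N * (E r i)^-1)).
  by rewrite ler_pdivlMr.
by rewrite ler_wpM2l// mulr_ge0// ltW.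
Qed.

(** Submultiplicativity splits off the index [i.+1], so that [E_shift] applies at [n]; the
    translation bound then restores [n.+1 + i]. *)
Lemma E_shift_translate J r : exists q : nat, exists2 c : R, 0 < c &
  forall n i, (i <= J)%N ->
    A n.+1 * E r (n.+1 + i)%N <= c * (A n * E q (n.+1 + i)%N).
Proof.
have [q1 [c1 c10 c1P]] := E_shift r.
have [q2 [c2 c20 c2P]] := E_le_translate J q1.
pose m := \sum_(i < J.+1) E r i.+1.
exists q2; exists (m * c1 * c2).
  rewrite !mulr_gt0// /m big_ord_recl ltr_wpDr// sumr_ge0// => i _.
  exact: ltW.
move=> n i iJ.
have h : E r i.+1 <= m.
  have iJ' : (i < J.+1)%N by [].
  rewrite /m (bigD1 (Ordinal iJ'))//= lerDl sumr_ge0// => k _.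
  exact: ltW.
have m0 : 0 <= m by apply: le_trans h; exact: ltW.
apply: (@le_trans _ _ (A n.+1 * (E r n * E r i.+1))).
  by rewrite ler_pM2l// addSnnS.
rewrite mulrA; apply: (@le_trans _ _ (c1 * (A n * E q1 n.+1) * m)).
  by apply: ler_pM => //; rewrite ?mulr_ge0// ltW.
rewrite (_ : c1 * _ * m = m * c1 * A n * E q1 n.+1);
  last by ring.
rewrite (_ : m * c1 * c2 * _ = m * c1 * A n * (c2 * E q2 (n.+1 + i)%N));
  last by ring.
by rewrite ler_wpM2l ?c2P// !mulr_ge0// ltW.
Qed.

(** Each step lowers the argument of [A] by one and leaves that of [E] in place; the lost unit goes
    into [j], so the induction hypothesis is used at [L.+1]. *)
Lemma E_iter_shift J L r : exists q : nat, exists2 c : R, 0 < c &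
  forall n i j, (i <= J)%N -> (j <= L)%N ->
    A (n + i)%N * E r (n + i + j)%N <= c * (A n * E q (n + i + j)%N).
Proof.
elim: J L r => [|J IH] L r.
  exists r, 1 => // n i j; rewrite leqn0 => /eqP -> _.
  by rewrite addn0 mul1r.
have [q1 [c1 c10 c1P]] := E_shift_translate L r.
have [q2 [c2 c20 c2P]] := IH L.+1 q1.
exists (maxn r q2); exists (1 + c1 * c2); first by rewrite addr_gt0// mulr_gt0.
move=> n [|i] j iJ jL.
  rewrite addn0 mulrDl mul1r ler_wpDr//.
    by rewrite !mulr_ge0// ltW.
  by rewrite ler_pM2l// E_mono// leq_maxl.
rewrite mulrDl mul1r ler_wpDl//; first by rewrite !mulr_ge0// ltW.
have := c1P (n + i)%N j jL; rewrite -addnS => /le_trans; apply.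
rewrite -mulrA ler_pM2l//.
have := c2P n i j.+1 iJ jL; rewrite -!addnA addSnnS => /le_trans; apply.
by rewrite ler_pM2l// ler_pM2l// E_mono// leq_maxr.
Qed.

(** Since the index of [E] does not move, the factors [A (n + i)] are exchanged for [A n] one at a
    time. *)
Lemma E_iter_shift_exp J M r : exists q : nat, exists2 c : R, 0 < c &
  forall n i, (i <= J)%N ->
    A (n + i)%N ^+ M * E r (n + i)%N <= c * (A n ^+ M * E q (n + i)%N).
Proof.
elim: M => [|M [q1 [c1 c10 c1P]]].
  by exists r, 1 => // n i _; rewrite !expr0 !mul1r.
have [q2 [c2 c20 c2P]] := E_iter_shift J 0 q1.
exists q2; exists (c1 * c2); first exact: mulr_gt0.
move=> n i iJ; rewrite !exprS -mulrA.
apply: (@le_trans _ _ (A (n + i)%N * (c1 * (A n ^+ M * E q1 (n + i)%N)))).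
  by rewrite ler_pM2l// c1P.
have := c2P n i 0%N iJ (leqnn _); rewrite addn0 => h.
rewrite (_ : A (n + i)%N * _ = c1 * A n ^+ M * (A (n + i)%N * E q1 (n + i)%N));
  last by ring.
rewrite (_ : c1 * c2 * _ = c1 * A n ^+ M * (c2 * (A n * E q2 (n + i)%N)));
  last by ring.
by rewrite ler_wpM2l// mulr_ge0 ?exprn_ge0// ltW.
Qed.

Lemma E_exp_le M r : (0 < M)%N -> exists q : nat, exists2 c : R, 0 < c &
  forall n, E r n ^+ M <= c * E q (n * M)%N.
Proof.
case: M => // M _; elim: M => [|M [q1 [c1 c10 c1P]]].
  by exists r, 1 => // n; rewrite expr1 mul1r muln1.
have [q2 [c2 c20 c2P]] := E_supmul (maxn r q1).
exists q2; exists (c1 * c2); first exact: mulr_gt0.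
move=> n; rewrite exprS mulnS.
apply: (@le_trans _ _ (E (maxn r q1) n * (c1 * E (maxn r q1) (n * M.+1)%N))).
  apply: ler_pM; rewrite ?exprn_ge0// ?E_mono ?leq_maxl//; try exact: ltW.
  by apply: (le_trans (c1P n)); rewrite ler_pM2l// E_mono// leq_maxr.
by rewrite mulrCA -mulrA ler_pM2l.
Qed.

Lemma E_mul_le q n k : (0 < k)%N -> E q (k * n)%N <= E q n ^+ k.
Proof.
case: k => // k _; elim: k => [|k IH]; first by rewrite mul1n expr1.
rewrite mulSn exprS (le_trans (E_submul _ _ _))//.
by rewrite ler_pM2l.
Qed.

(** Round the index given by [E_small] down to a multiple of [M]: it moves by less than [M], which
    the translation bounds absorb. *)
Lemma E_small_mul M q (eta : R) n0 : (0 < M)%N -> 0 < eta ->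
  exists2 s, (n0 <= s)%N & E q (s * M)%N < eta * A (s * M)%N.
Proof.
move=> M0 eta0.
have [q1 [c1 c10 c1P]] := E_le_translate M q.
have [q2 [c2 c20 c2P]] := E_iter_shift_exp M 1 q1.
have c0 : 0 < c1 * c2 by exact: mulr_gt0.
have [n nn0 nP] := @E_small q2 (eta / (c1 * c2)) (n0 * M)%N (divr_gt0 eta0 c0).
exists (n %/ M)%N; first by rewrite leq_divRL.
set m := (n %/ M * M)%N; set i := (n %% M)%N.
have en : n = (m + i)%N by exact: divn_eq.
have iM : (i <= M)%N by rewrite ltnW// ltn_mod.
rewrite -(ltr_pM2r (A_gt0 n)).
apply: (@le_lt_trans _ _ (c1 * c2 * (A m * E q2 n))).
  have := c2P m i iM; rewrite -en !expr1 => h.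
  have := c1P m i iM; rewrite -en => h1.
  apply: (@le_trans _ _ (c1 * (A n * E q1 n))).
    by rewrite mulrC mulrCA ler_pM2l.
  by rewrite -mulrA ler_pM2l.
rewrite (_ : eta * A m * A n = (c1 * c2) * (A m * (eta / (c1 * c2) * A n))).
  by rewrite ltr_pM2l// ltr_pM2l.
by field; lra.
Qed.

Lemma exists_root (M : nat) (x : R) : (0 < M)%N -> 0 < x ->
  exists2 t : R, 0 < t & t ^+ M = x.
Proof.
move=> M0 x0; exists (x `^ M%:R^-1); first exact: powR_gt0.
by rewrite -powR_mulrn ?powR_ge0// -powRrM mulVf ?pnatr_eq0 -?lt0n// powRr1// ltW.
Qed.

(** The equation determines [t]. The bounds come from the smallness of [E] at [s * M], which
    dominates the [M]-th power of [E] at [s], while the quotients of [A] only cost a change of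
    seminorm. *)
Lemma exists_scale M k J r (delta eta : R) s0 : (0 < M)%N -> (0 < k)%N ->
    0 < delta <= 1 -> 0 < eta ->
  exists2 s, (s0 <= s)%N & exists2 t : R, 0 < t &
  [/\ t ^+ M * A (s * M)%N = delta, t * E r s < eta &
      forall i, (i <= J)%N ->
        A (s * M)%N / A (s * M - i)%N * t ^+ k * E r (k * s - i)%N < eta].
Proof.
move=> M0 k0 /andP[d0 d1] eta0.
have [q1' [c1 c10 c1P]] := E_le_translate J r.
pose q1 := maxn r q1'.
have [q2 [c2 c20 c2P]] := E_exp_le q1 M0.
have [q3' [c3 c30 c3P]] := E_iter_shift_exp J M q2.
pose q3 := maxn q2 q3'.
(* [z] will bound [t * E q1 s], even multiplied by a quotient of [A]; what is needed of it is
   [z <= 1], [z <= eta] and [c1 * z < eta]. *)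
pose z := Num.min (eta / (1 + c1)) (Num.min eta 1).
have z0 : 0 < z by rewrite !lt_min eta0 ltr01 divr_gt0// addr_gt0.
have z1 : z <= 1 by rewrite !ge_min lexx !orbT.
have zeta : z <= eta by rewrite !ge_min lexx !orbT.
have zc : c1 * z < eta.
  apply: (@le_lt_trans _ _ (c1 * (eta / (1 + c1)))).
    by rewrite ler_pM2l// ge_min lexx.
  rewrite mulrA ltr_pdivrMr ?addr_gt0//; nra.
(* Chosen so that the [M]-th power of the quantity in [key] is at most [z ^+ M * (c3 / (1 + c3))],
   strictly below [z ^+ M]. *)
pose th := z ^+ M / (c2 * (1 + c3)).
have th0 : 0 < th by rewrite divr_gt0 ?exprn_gt0// mulr_gt0// addr_gt0.
have [s ss0 sP] := @E_small_mul M q3 th (maxn s0 J) M0 th0.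
rewrite geq_max in ss0; case/andP: ss0 => ss0 sJ.
exists s => //; set n := (s * M)%N in sP *.
have [t t0 tP] := exists_root M0 (divr_gt0 d0 (A_gt0 n)).
have tA : t ^+ M * A n = delta by rewrite tP divfK// gt_eqF.
exists t => //.
(* Both sides are compared through their [M]-th powers, where [t ^+ M * A n] is [delta <= 1]. *)
have key i : (i <= J)%N -> A n / A (n - i)%N * (t * E q1 s) < z.
  move=> iJ; set P := _ / _.
  have P0 : 0 < P by rewrite divr_gt0.
  have sn : (s <= n)%N by rewrite leq_pmulr.
  have := c3P (n - i)%N i iJ; rewrite subnK; last first.
    exact: leq_trans iJ (leq_trans sJ sn).
  move=> h.
  have hP : P ^+ M * E q2 n <= c3 * E q3 n.
    rewrite /P expr_div_n mulrAC ler_pdivrMr ?exprn_gt0//.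
    apply: (le_trans h); rewrite mulrA [leRHS]mulrAC ler_pM2l ?mulr_gt0 ?exprn_gt0//.
    by rewrite E_mono// leq_maxr.
  clearbody P.
  have tE0 : 0 <= P * (t * E q1 s) by rewrite !mulr_ge0// ltW.
  rewrite -(@ltr_pXn2r _ M)// ?nnegrE ?(ltW z0)// !exprMn.
  apply: (@le_lt_trans _ _ (P ^+ M * (t ^+ M * (c2 * E q2 n)))).
    by rewrite !ler_wpM2l ?exprn_ge0 ?c2P// ltW.
  rewrite [ltLHS](_ : _ = t ^+ M * c2 * (P ^+ M * E q2 n)); last by ring.
  apply: (@le_lt_trans _ _ (t ^+ M * c2 * (c3 * E q3 n))).
    by rewrite ler_pM2l// mulr_gt0 ?exprn_gt0.
  apply: (@lt_trans _ _ (t ^+ M * c2 * (c3 * (th * A n)))).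
    by rewrite ltr_pM2l ?ltr_pM2l// mulr_gt0 ?exprn_gt0.
  rewrite [ltLHS](_ : _ = t ^+ M * A n * (c2 * c3 * th)); last by ring.
  rewrite tA.
  have -> : c2 * c3 * th = z ^+ M * (c3 / (1 + c3)).
    by rewrite /th; field; lra.
  apply: (@le_lt_trans _ _ (1 * (z ^+ M * (c3 / (1 + c3))))).
    by rewrite ler_wpM2r// mulr_ge0 ?exprn_ge0 ?divr_ge0 ?addr_ge0// ltW.
  rewrite mul1r gtr_pMr ?exprn_gt0// ltr_pdivrMr ?addr_gt0//; lra.
have tz : t * E q1 s < z.
  by have := key 0%N isT; rewrite subn0 divff ?gt_eqF// mul1r.
have tr : t * E r s <= t * E q1 s by rewrite ler_pM2l// E_mono// leq_maxl.
split => //; first by rewrite (le_lt_trans tr)// (lt_le_trans tz).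
move=> i iJ; apply: le_lt_trans zc.
have P0 : 0 < A n / A (n - i)%N by rewrite divr_gt0.
have tE0 : 0 < t * E q1 s by rewrite mulr_gt0.
apply: (@le_trans _ _ (A n / A (n - i)%N * t ^+ k * (c1 * E q1 s ^+ k))).
  rewrite ler_pM2l ?(mulr_gt0 P0) ?exprn_gt0//.
  have sk : (s <= k * s)%N by rewrite leq_pmull.
  have := c1P (k * s - i)%N i iJ; rewrite subnK; last first.
    exact: leq_trans iJ (leq_trans sJ sk).
  move/le_trans; apply; rewrite ler_pM2l//.
  by rewrite (le_trans _ (E_mul_le _ _ _))// E_mono// leq_maxr.
rewrite [leLHS](_ : _ = c1 * (A n / A (n - i)%N * (t * E q1 s) ^+ k)); last first.
  by rewrite exprMn; ring.
rewrite ler_pM2l//; apply: le_trans (ltW (key i iJ)); rewrite (ler_pM2l P0).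
(* One of the [k] factors [t * E q1 s] is kept for [key]; the others are at most 1. *)
case: k k0 => // k _; rewrite exprS ler_piMr//; first exact: ltW.
by rewrite exprn_ile1// ltW// (lt_le_trans tz).
Qed.

End Growth.

(** * Formal power series and monomials *)

(** A copy of [omega R] whose ring product is the Cauchy product, since functions already carry the
    pointwise one. *)
Definition fps (R : realType) : Type := omega R.

Section PowerSeries.
Context (R : realType).
Local Notation ps := (fps R).
Implicit Types x y z : ps.

HB.instance Definition _ := GRing.Lmodule.copy ps (omega R).

Definition ps_trunc n x : {poly R[i]} := \poly_(i < n.+1) x i.

Definition ps_of_poly (p : {poly R[i]}) : ps := fun n => p`_n.

(** Coefficients up to [n] of a product only depend on truncations, so commutativity and
    associativity are inherited from polynomials. *)
Lemma coef_ps_truncM n k x y : (k <= n)%N ->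
  (ps_trunc n x * ps_trunc n y)`_k = cauchy_prod x y k.
Proof.
move=> kn; rewrite coefM; apply: eq_bigr => j _.
have jk : (j <= k)%N by rewrite -ltnS.
by rewrite !coef_poly !ltnS (leq_trans jk kn) (leq_trans (leq_subr _ _) kn).
Qed.

Lemma ps_mulC : commutative (@cauchy_prod R).
Proof.
move=> x y; apply/funext => n.
by rewrite -(@coef_ps_truncM n n x y)// -(@coef_ps_truncM n n y x)// mulrC.
Qed.

Lemma ps_mulA : associative (@cauchy_prod R).
Proof.
move=> x y z; apply/funext => n.
transitivity ((ps_trunc n x * (ps_trunc n y * ps_trunc n z))`_n).
  rewrite coefM; apply: eq_bigr => j _.
  by rewrite coef_ps_truncM ?leq_subr// coef_poly ltn_ord.
rewrite mulrA coefM; apply: eq_bigr => j _.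
have jn : (j <= n)%N by rewrite -ltnS.
by rewrite coef_ps_truncM// coef_poly ltnS leq_subr.
Qed.

Lemma ps_mul1 : left_id (ps_of_poly 1) (@cauchy_prod R).
Proof.
move=> x; apply/funext => n.
rewrite /cauchy_prod big_ord_recl subn0 big1 ?addr0.
  by rewrite /ps_of_poly coef1 mul1r.
by move=> j _; rewrite /ps_of_poly coef1 mul0r.
Qed.

Lemma ps_mulDl : left_distributive (@cauchy_prod R) +%R.
Proof.
move=> x y z; apply/funext => n; 
rewrite -[RHS]/(cauchy_prod x z n + cauchy_prod y z n) /cauchy_prod -big_split.
by apply: eq_bigr => j _; exact: mulrDl.
Qed.

Lemma ps_1_neq0 : ps_of_poly 1 != 0.
Proof.
apply/eqP => /(congr1 (fun f : ps => f 0%N)); rewrite /ps_of_poly coef1/=.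
exact/eqP/oner_neq0.
Qed.

HB.instance Definition _ := GRing.Zmodule_isComNzRing.Build ps
  ps_mulA ps_mulC ps_mul1 ps_mulDl ps_1_neq0.

Lemma ps_scaleAl (a : R[i]) x y : a *: (x * y) = (a *: x) * y.
Proof.
apply/funext => n; rewrite -[LHS]/(a * cauchy_prod x y n) mulr_sumr.
by apply: eq_bigr => j _; rewrite mulrA.
Qed.

HB.instance Definition _ := GRing.Lmodule_isLalgebra.Build R[i] ps ps_scaleAl.
HB.instance Definition _ := GRing.Lalgebra_isComAlgebra.Build R[i] ps.

Lemma ps_of_poly_is_additive : zmod_morphism ps_of_poly.
Proof. by move=> p q; apply/funext => n; rewrite /ps_of_poly coefB. Qed.

Lemma ps_of_poly_is_multiplicative : monoid_morphism ps_of_poly.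
Proof.
by split=> // p q; apply/funext => n; rewrite /ps_of_poly coefM.
Qed.

HB.instance Definition _ := GRing.isZmodMorphism.Build {poly R[i]} ps
  ps_of_poly ps_of_poly_is_additive.
HB.instance Definition _ := GRing.isMonoidMorphism.Build {poly R[i]} ps
  ps_of_poly ps_of_poly_is_multiplicative.

End PowerSeries.

(** Induction on nonconstant monomials: the variables are the prime indices, and every index above 1
    is a product of primes. *)
Lemma prime_mul_ind (P : nat -> Prop) :
    (forall p, prime p -> P p) ->
    (forall k l, (1 < k)%N -> (1 < l)%N -> P k -> P l -> P (k * l)%N) ->
  forall k, (1 < k)%N -> P k.
Proof.
move=> Pp PM k; elim/ltn_ind: k => k IH k1.
have [kp|kNp] := boolP (prime k); first exact: Pp.
have kE : k = (pdiv k * (k %/ pdiv k))%N by rewrite mulnC divnK// pdiv_dvd.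
have pk : (pdiv k < k)%N.
  rewrite ltn_neqAle dvdn_leq ?pdiv_dvd 1?ltnW// andbT.
  by apply: contra kNp => /eqP <-; rewrite pdiv_prime.
have p1 : (1 < pdiv k)%N by rewrite prime_gt1// pdiv_prime.
have q1 : (1 < k %/ pdiv k)%N by rewrite ltn_divRL ?pdiv_dvd// mul1n.
rewrite kE; apply: PM => //; apply: IH => //.
by rewrite ltn_Pdiv// ltnW.
Qed.

Section Monomials.
Context (S : comNzRingType).
Implicit Type u : nat -> S.

(* The monomials in the variables [u p], [p] prime, are indexed by the positive
   integers: multiplying monomials amounts to multiplying their indices. *)
Definition mon u (k : nat) : S := \prod_(p < k.+1) u p ^+ logn p k.

Lemma mon_widen u k n : (0 < k < n)%N -> mon u k = \prod_(p < n) u p ^+ logn p k.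
Proof.
case/andP=> k0 kn; rewrite /mon.
rewrite -!(big_mkord xpredT (fun p => u p ^+ logn p k)).
rewrite (big_cat_nat (leq0n _) kn)/=.
rewrite [X in _ = _ * X]big_nat_cond [X in _ = _ * X]big1 ?mulr1//.
move=> p; rewrite andbT => /andP[kp _].
by rewrite ltn_log0.
Qed.

Lemma monM u k l : (0 < k)%N -> (0 < l)%N -> mon u (k * l)%N = mon u k * mon u l.
Proof.
move=> k0 l0; have kl0 : (0 < k * l)%N by rewrite muln_gt0 k0.
rewrite (@mon_widen u k (k * l).+1) ?k0/= ?ltnS ?leq_pmulr//.
rewrite (@mon_widen u l (k * l).+1) ?l0/= ?ltnS ?leq_pmull//.
by rewrite -big_split; apply: eq_bigr => p _; rewrite lognM// exprD.
Qed.

Lemma mon_prime u p : prime p -> mon u p = u p.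
Proof.
move=> pp; rewrite /mon big_ord_recr/= logn_prime// eqxx expr1.
rewrite big1 ?mul1r// => j _.
by rewrite logn_prime// (ltn_eqF (ltn_ord j)) expr0.
Qed.

End Monomials.

Lemma rmorph_mon (S S' : comNzRingType) (f : {rmorphism S -> S'}) (u : nat -> S)
  k : f (mon u k) = mon (f \o u) k.
Proof. by rewrite rmorph_prod; apply: eq_bigr => p _; rewrite rmorphXn. Qed.

(* The degree of the monomial of index [k] when [u p] has degree [a p]. *)
Definition weight (a : nat -> nat) k := (\sum_(p < k.+1) a p * logn p k)%N.

Lemma weight_widen a k n : (0 < k < n)%N ->
  weight a k = (\sum_(p < n) a p * logn p k)%N.
Proof.
case/andP=> k0 kn; rewrite /weight.
rewrite -!(big_mkord xpredT (fun p => a p * logn p k)%N).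
rewrite (big_cat_nat (leq0n _) kn)/=.
rewrite [X in _ = (_ + X)%N]big_nat_cond [X in _ = (_ + X)%N]big1 ?addn0//.
by move=> p; rewrite andbT => /andP[kp _]; rewrite ltn_log0// muln0.
Qed.

Lemma weightM a k l : (0 < k)%N -> (0 < l)%N ->
  weight a (k * l)%N = (weight a k + weight a l)%N.
Proof.
move=> k0 l0; have kl0 : (0 < k * l)%N by rewrite muln_gt0 k0.
rewrite (@weight_widen a k (k * l).+1) ?k0/= ?ltnS ?leq_pmulr//.
rewrite (@weight_widen a l (k * l).+1) ?l0/= ?ltnS ?leq_pmull//.
by rewrite -big_split; apply: eq_bigr => p _; rewrite lognM// mulnDr.
Qed.

Lemma weight_prime a p : prime p -> weight a p = a p.
Proof.
move=> pp; rewrite /weight big_ord_recr/= logn_prime// eqxx muln1.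
rewrite big1// => j _.
by rewrite logn_prime// (ltn_eqF (ltn_ord j)) muln0.
Qed.

Lemma digits_inj B n (a b : nat -> nat) :
    (forall p, a p < B)%N -> (forall p, b p < B)%N ->
    (\sum_(p < n) B ^ p * a p = \sum_(p < n) B ^ p * b p)%N ->
  forall p, (p < n)%N -> a p = b p.
Proof.
elim: n a b => // n IH a b aB bB.
have split_digit (f : nat -> nat) :
    (\sum_(p < n.+1) B ^ p * f p = (\sum_(p < n) B ^ p * f p.+1) * B + f 0)%N.
  rewrite big_ord_recl/= mul1n addnC big_distrl/=; congr (_ + _)%N.
  by apply: eq_bigr => p _; rewrite expnS -mulnA mulnC.
rewrite !split_digit => ab.
have B0 : (0 < B)%N by exact: leq_ltn_trans (aB 0%N).
have ab0 : a 0%N = b 0%N.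
  by have := congr1 (modn^~ B) ab; rewrite !modnMDl !modn_small.
move: ab; rewrite ab0 => /addIn/eqP; rewrite eqn_pmul2r// => /eqP ab [//|p] pn.
exact: (IH (fun p => a p.+1) (fun p => b p.+1)).
Qed.

(** In base [B] the digits of the weight are the exponents [logn p k], each smaller than [B] because
    [k] is; they determine [k]. *)
Lemma weight_inj B k l : (0 < k < B)%N -> (0 < l < B)%N ->
  weight (expn B) k = weight (expn B) l -> k = l.
Proof.
move=> kB lB; rewrite (weight_widen _ kB) (weight_widen _ lB) => kl.
case/andP: (kB) => k0 kB'; case/andP: (lB) => l0 lB'.
have logB p m : (0 < m < B)%N -> (logn p m < B)%N.
  case/andP=> m0 mB; apply: leq_ltn_trans mB.
  have [/(ltn_expl (logn p m)) h|p1] := ltnP 1 p.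
    by apply: (leq_trans (ltnW h)); rewrite dvdn_leq// pfactor_dvdnn.
  by case: p p1 => [|[|]].
apply: eqn_from_log => // p.
have [pB|Bp] := ltnP p B; last first.
  by rewrite !ltn_log0// (leq_trans _ Bp).
exact: (digits_inj (fun p => logB p k kB) (fun p => logB p l lB) kl).
Qed.

(** * Leading terms of polynomials modulo low degrees *)

Section LeadingTerm.
Context (F : fieldType) (H J : nat).
Hypothesis HJ : (2 * H <= J.+1)%N.
Implicit Types p q D : {poly F}.

(* [p] is [c X^a + X^(a-J) D] up to terms of degree less than [a - J]; modulo
   such terms, these expressions multiply like dual numbers. *)
Definition leading a (c : F) D p :=
  (size ('X^J * p - 'X^a * (c *: 'X^J + D))%R <= a)%N.

(** The only product not of dual-number type and not involving a remainder is [D * D']; its size is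
    at most [J] by [HJ], so it is negligible. Everything is computed after multiplication by ['X^J],
    which avoids negative exponents. *)
Lemma leadingM a a' c c' D D' p p' : (size D <= H)%N -> (size D' <= H)%N ->
  leading a c D p -> leading a' c' D' p' ->
  leading (a + a')%N (c * c') (c *: D' + c' *: D) (p * p').
Proof.
rewrite /leading => DH D'H.
set r := 'X^J * p - _; set r' := 'X^J * p' - _ => ra ra'.
have eJp : 'X^J * p = 'X^a * (c *: 'X^J + D) + r by rewrite addrC subrK.
have eJp' : 'X^J * p' = 'X^a' * (c' *: 'X^J + D') + r' by rewrite addrC subrK.
set g := _ - _.
have eg : 'X^J * g = 'X^(a + a') * (D * D') + r * ('X^a' * (c' *: 'X^J + D'))
    + 'X^a * (c *: 'X^J + D) * r' + r * r'.
  have -> : 'X^J * g = ('X^J * p) * ('X^J * p') -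
     'X^J * ('X^(a + a') * ((c * c') *: 'X^J + (c *: D' + c' *: D))).
    by rewrite /g; ring.
  by rewrite eJp eJp' exprD -!mul_polyC polyCM; ring.
have sE b (d : F) (P : {poly F}) : (size P <= H)%N ->
    (size ('X^b * (d *: 'X^J + P))%R <= b + J.+1)%N.
  move=> PH; apply: (leq_trans (size_polyMleq _ _)).
  rewrite size_polyXn addSn/= leq_add2l (leq_trans (size_polyD _ _))//.
  rewrite geq_max (leq_trans (size_scale_leq _ _)) ?size_polyXn//=.
  by rewrite (leq_trans PH)//; lia.
have sg : (size ('X^J * g)%R <= a + a' + J)%N.
  rewrite eg.
  do !(apply: (leq_trans (size_polyD _ _)); rewrite geq_max; apply/andP; split).
  - apply: (leq_trans (size_polyMleq _ _)); rewrite size_polyXn addSn/= leq_add2l.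
    by apply: (leq_trans (size_polyMleq _ _)); lia.
  - apply: (leq_trans (size_polyMleq _ _)).
    have := sE a' c' D' D'H; move: (size r) ra (size _) => m ra n; lia.
  - apply: (leq_trans (size_polyMleq _ _)).
    have := sE a c D DH; move: (size r') ra' (size _) => m ra' n; lia.
  - apply: (leq_trans (size_polyMleq _ _)).
    move: (size r) (size r') ra ra' => m n; lia.
have [->|g0] := eqVneq g 0; first by rewrite size_poly0.
by move: sg; rewrite size_monicM ?monicXn// size_polyXn addSn/= addnC leq_add2r.
Qed.

Lemma leading_size a c D p : (size D <= H)%N -> leading a c D p ->
  (size p <= a.+1)%N.
Proof.
rewrite /leading => DH; set r := _ - _ => ra.
have eJp : 'X^J * p = 'X^a * (c *: 'X^J + D) + r by rewrite addrC subrK.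
have [->|p0] := eqVneq p 0; first by rewrite size_poly0.
suff : (size ('X^J * p)%R <= a + J.+1)%N.
  by rewrite size_monicM ?monicXn// size_polyXn addSn/= addnC -addSnnS leq_add2r.
rewrite eJp (leq_trans (size_polyD _ _))// geq_max; apply/andP; split; last lia.
apply: (leq_trans (size_polyMleq _ _)).
rewrite size_polyXn addSn/= leq_add2l (leq_trans (size_polyD _ _))//.
rewrite geq_max (leq_trans (size_scale_leq _ _)) ?size_polyXn//=.
by rewrite (leq_trans DH)//; lia.
Qed.

Lemma leading_coef a c D p l : (J <= a)%N -> leading a c D p ->
  p`_(a - J + l)%N = c * (l == J)%:R + D`_l.
Proof.
move=> Ja; rewrite /leading => /leq_sizeP /(_ (a + l)%N (leq_addr _ _)).
rewrite coefB !coefXnM !ltnNge leq_addr (leq_trans Ja) ?leq_addr//=.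
rewrite addKn coefD coefZ coefXn => /eqP; rewrite subr_eq0 => /eqP <-.
by congr (p`_ _); rewrite addnBAC.
Qed.

End LeadingTerm.

(** * Seminorms and topology *)

Lemma normc_ge0_real (R : realType) (t : R) : 0 <= t -> normc (t%:C)%C = t.
Proof.
by move=> t0; rewrite /normc /= expr0n addr0 sqrtr_sqr ger0_norm.
Qed.

Section Seminorms.
Context (R : realType) (X : seqAlgebra R).
Implicit Types (x y z : X) (q : nat) (e : R).

Lemma seq_of_inj : injective (@seq_of R X).
Proof. exact: val_inj. Qed.

Lemma sn_ge0 q x : 0 <= sn q x.
Proof. exact: seminorm_ge0 (seq_ofP x). Qed.

Lemma snD q x y : sn q (x + y) <= sn q x + sn q y.
Proof. exact: seminormD (seq_ofP x) (seq_ofP y). Qed.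

Lemma snZ q (a : R[i]) x : sn q (a *: x) = normc a * sn q x.
Proof. exact: seminormZ (seq_ofP x). Qed.

Lemma sn_mono q r x : (q <= r)%N -> sn q x <= sn r x.
Proof. by move=> qr; exact: seminorm_nondecreasing (seq_ofP x). Qed.

Lemma snM q x y : sn q (seqalg_mul x y) <= sn q x * sn q y.
Proof. exact: seminormM (seq_ofP x) (seq_ofP y). Qed.

Lemma snBC q x y : sn q (x - y) = sn q (y - x).
Proof. by rewrite -snN opprB. Qed.

Lemma sn_sum q (I : Type) (s : seq I) (P : pred I) (f : I -> X) :
  sn q (\sum_(i <- s | P i) f i) <= \sum_(i <- s | P i) sn q (f i).
Proof.
elim/big_ind2 : _ => [|x a y b xa yb|//]; first by rewrite sn0.
exact: (le_trans (snD _ _ _) (lerD xa yb)).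
Qed.

Lemma nbhs_snP x (A : set X) : nbhs x A <->
  exists q, exists2 e : R, 0 < e & forall y, sn q (y - x) < e -> A y.
Proof.
rewrite -nbhs_entourageE; split.
  move=> [B [q [e e0 qB]] BA]; exists q, e => // y ye; apply: BA.
  by rewrite /xsection/= inE; apply: qB; rewrite /= snBC.
move=> [q [e e0 qA]]; exists [set xy | sn q (xy.1 - xy.2) < e].
  by exists q, e.
by move=> y; rewrite /xsection/= inE/= snBC => /qA.
Qed.

Lemma cvg_snP (u : nat -> X) x : u @ \oo --> x <->
  forall q e, 0 < e -> exists n0, forall n, (n0 <= n)%N -> sn q (u n - x) < e.
Proof.
split=> [ux q e e0|ux A /nbhs_snP[q [e e0 qA]]].
  have : nbhs x [set y | sn q (y - x) < e] by apply/nbhs_snP; exists q, e.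
  by move/ux => -[n0 _ n0P]; exists n0 => n n0n; exact: n0P.
have [n0 n0P] := ux q e e0.
by exists n0 => // n n0n; apply: qA; exact: n0P.
Qed.

Lemma dense_snP (A : set X) : dense A <->
  forall x q e, 0 < e -> exists2 a, A a & sn q (a - x) < e.
Proof.
split=> [dA x q e e0|dA O [x Ox] Oo].
  have nB : nbhs x [set y | sn q (y - x) < e] by apply/nbhs_snP; exists q, e.
  have [y [/interior_subset By Ay]] := dA _ (ex_intro _ x nB) (open_interior _).
  by exists y.
have /nbhs_snP[q [e e0 qO]] : nbhs x O by apply: open_nbhs_nbhs.
by have [a Aa ax] := dA x q e e0; exists a; split => //; exact: qO.
Qed.

Lemma complete_sn : is_frechet_seq_algebra X -> forall u : nat -> X,
    (forall q e, 0 < e -> exists n0, forall m n, (n0 <= m)%N -> (n0 <= n)%N ->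
      sn q (u m - u n) < e) ->
  exists x, u @ \oo --> x.
Proof.
move=> [_ cX _] u uC; apply: cX => A [q [e e0 qA]].
have [n0 n0P] := uC q e e0.
pose B := u @` [set n | (n0 <= n)%N].
exists (B, B) => /=; first by split; exists n0 => // n n0n; exists n.
by move=> [_ _] [/= [m mn0 <-] [n nn0 <-]]; apply: qA; exact: n0P.
Qed.

Lemma continuous_sn_le (T : {linear X -> X}) : continuous T ->
  forall r, exists q, exists2 c : R, 0 < c & forall x, sn r (T x) <= c * sn q x.
Proof.
move=> cT r.
have : nbhs (0 : X) (T @^-1` [set y | sn r y < 1]).
  apply: (cT 0); apply/nbhs_snP; exists r, 1 => // y.
  by rewrite linear0 subr0.
move=> /nbhs_snP[q [e e0 qP]]; exists q, (2 / e); first by rewrite divr_gt0.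
move=> x; apply/ler_addgt0Pr => h h0.
(* [t] scales [x] into the ball of radius [e]. The summand [h * (e / 2)] keeps the denominator
   positive when [sn q x] vanishes and becomes the additive error [h]. *)
pose t := e / 2 / (sn q x + h * (e / 2)).
have sx := sn_ge0 q x.
have d0 : 0 < sn q x + h * (e / 2) by rewrite ltr_wpDl// !mulr_gt0// ?invr_gt0.
have t0 : 0 < t by rewrite !divr_gt0.
have nt : normc (t%:C)%C = t by rewrite normc_ge0_real// ltW.
have := qP ((t%:C)%C *: x); rewrite subr0 /= linearZ/= !snZ nt => ht.
have : t * sn r (T x) < 1.
  apply: ht; rewrite /t mulrAC ltr_pdivrMr//.
  rewrite (mulrC _ (sn q x)); nra.
rewrite mulrC -ltr_pdivlMr// mul1r /t invf_div => /ltW/le_trans; apply.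
by rewrite le_eqVlt; apply/orP; left; apply/eqP; field; lra.
Qed.

End Seminorms.

Lemma normcX (R : realType) (x : R[i]) n : normc (x ^+ n) = normc x ^+ n.
Proof.
elim: n => [|n IH]; first by rewrite !expr0 ComplexField.Normc.normc1.
by rewrite !exprS ComplexField.Normc.normcM IH.
Qed.

Lemma normc_ge0 (R : realType) (x : R[i]) : 0 <= normc x.
Proof. by case: x => a b; exact: sqrtr_ge0. Qed.

Lemma normc_gt0 (R : realType) (x : R[i]) : x != 0 -> 0 < normc x.
Proof.
move=> x0; rewrite lt_neqAle normc_ge0 andbT eq_sym.
by apply: contra x0 => /eqP/ComplexField.Normc.eq0_normc/eqP.
Qed.

Lemma ltr_normC (R : realType) (x : R[i]) (e : R) :
  (`|x| < (e%:C)%C) = (normc x < e).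
Proof. by rewrite normc_def ltcR; case: x. Qed.

(** * Products and monomials in the algebra *)

Section Products.
Context (R : realType) (X : seqAlgebra R).
Implicit Types (x y z : X) (u : nat -> X) (q : nat) (e : R).

Lemma seqalg_mulBl x y z : seqalg_mul (x - y) z = seqalg_mul x z - seqalg_mul y z.
Proof.
apply/seq_of_inj; rewrite -[LHS]/(cauchy_prod (seq_of (x - y)) (seq_of z)).
by rewrite !linearB; exact: (@mulrBl (fps R) (seq_of z) (seq_of x) (seq_of y)).
Qed.

Lemma seqalg_mulBr x y z : seqalg_mul x (y - z) = seqalg_mul x y - seqalg_mul x z.
Proof.
apply/seq_of_inj; rewrite -[LHS]/(cauchy_prod (seq_of x) (seq_of (y - z))).
by rewrite !linearB; exact: (@mulrBr (fps R) (seq_of x) (seq_of y) (seq_of z)).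
Qed.

(* The junk value [0] is taken when [mon] is not in [X], possibly for [k <= 1]
   since [X] need not contain the empty product. *)
Definition xmon u k : X :=
  insubd (0 : X) (mon ((fun p => seq_of (u p)) : nat -> fps R) k : omega R).

Lemma seq_of_xmon u k : (1 < k)%N ->
  seq_of (xmon u k) = mon ((fun p => seq_of (u p)) : nat -> fps R) k.
Proof.
move=> k1; rewrite /xmon; apply: insubdK.
move: k k1; apply: prime_mul_ind => [p pp|k l k1 l1 kX lX].
  by rewrite mon_prime//; exact: seq_ofP.
by rewrite monM ?(ltnW k1) ?(ltnW l1)//; exact: cauchy_prod_closed.
Qed.

Lemma xmon_prime u p : prime p -> xmon u p = u p.
Proof.
by move=> pp; apply/seq_of_inj; rewrite seq_of_xmon ?prime_gt1// mon_prime.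
Qed.

Lemma xmonM u k l : (1 < k)%N -> (1 < l)%N ->
  xmon u (k * l)%N = seqalg_mul (xmon u k) (xmon u l).
Proof.
move=> k1 l1; have kl1 : (1 < k * l)%N by rewrite (leq_trans k1)// leq_pmulr// ltnW.
apply/seq_of_inj; rewrite seq_of_xmon// monM ?(ltnW k1) ?(ltnW l1)//.
by rewrite -!seq_of_xmon.
Qed.

(** A product is handled by the usual splitting of a difference of products. A single [q] bounds
    both the variables and the seminorm, as in the balls of the Baire argument. *)
Lemma xmon_continuous u k : (1 < k)%N -> forall r e, 0 < e ->
  exists q, exists2 d : R, 0 < d & forall z : nat -> X,
    (forall i, (i <= q)%N -> sn q (z i - u i) <= d) ->
    sn r (xmon z k - xmon u k) < e.
Proof.
move: k; apply: prime_mul_ind => [p pp|k l k1 l1 IHk IHl] r e e0.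
  exists (maxn p r), (e / 2); first by rewrite divr_gt0.
  move=> z zu; rewrite !xmon_prime//.
  apply: (@le_lt_trans _ _ (e / 2)); last by lra.
  by apply: (le_trans _ (zu p (leq_maxl _ _))); rewrite sn_mono// leq_maxr.
have K0 := sn_ge0 r (xmon u k); have L0 := sn_ge0 r (xmon u l).
set K := sn r (xmon u k) in K0; set L := sn r (xmon u l) in L0.
have l0 : 0 < e / 2 / (L + 1) by rewrite !divr_gt0// ltr_wpDl.
have [q1 [d1 d10 h1]] := IHk r _ l0.
have m0 : 0 < Num.min 1 (e / 2 / (K + 1)) by rewrite lt_min ltr01 !divr_gt0// ltr_wpDl.
have [q2 [d2 d20 h2]] := IHl r _ m0.
exists (maxn q1 q2), (Num.min d1 d2); first by rewrite lt_min d10.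
move=> z zu.
have {}h1 : sn r (xmon z k - xmon u k) < e / 2 / (L + 1).
  apply: h1 => i iq; have := zu i (leq_trans iq (leq_maxl _ _)).
  by rewrite le_min => /andP[+ _]; apply: le_trans; rewrite sn_mono// leq_maxl.
have : sn r (xmon z l - xmon u l) < Num.min 1 (e / 2 / (K + 1)).
  apply: h2 => i iq; have := zu i (leq_trans iq (leq_maxr _ _)).
  by rewrite le_min => /andP[_]; apply: le_trans; rewrite sn_mono// leq_maxr.
rewrite lt_min => /andP[h21 h22].
have zL : sn r (xmon z l) <= L + 1.
  rewrite -[xmon z l](subrK (xmon u l)) (le_trans (snD _ _ _))// addrC lerD2l.
  exact: ltW.
rewrite !xmonM// (_ : _ - _ = seqalg_mul (xmon z k - xmon u k) (xmon z l) +
    seqalg_mul (xmon u k) (xmon z l - xmon u l)); last first.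
  by rewrite seqalg_mulBl seqalg_mulBr addrA subrK.
apply: (le_lt_trans (snD _ _ _)).
rewrite (splitr e); apply: ltr_leD.
  apply: (le_lt_trans (snM _ _ _)).
  apply: (@le_lt_trans _ _ (sn r (xmon z k - xmon u k) * (L + 1))).
    by rewrite ler_wpM2l// sn_ge0.
  by rewrite -ltr_pdivlMr// ltr_wpDl.
apply: (le_trans (snM _ _ _)); rewrite -/K.
apply: (@le_trans _ _ ((K + 1) * sn r (xmon z l - xmon u l))).
  by rewrite ler_wpM2r ?sn_ge0// lerDl.
by rewrite mulrC -ler_pdivlMr ?ltr_wpDl// ltW.
Qed.

End Products.

(** * Expansions in the Schauder basis *)

Section Basis.
Context (R : realType) (X : seqAlgebra R) (frechetX : is_frechet_seq_algebra X).
Context (e : nat -> X) (eE : forall n, e n = unit_seq R n :> omega R).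
Hypothesis basis_e : is_schauder_basis e.
Implicit Types (p : {poly R[i]}) (x y : X).

(** Polynomials encode the finitely supported elements of [X]. *)
Definition xpoly p : X := \sum_(i < size p) p`_i *: e i.

Lemma seq_of_sum_basis (a : nat -> R[i]) n k :
  seq_of (\sum_(i < n) a i *: e i) k = a k *+ (k < n)%N.
Proof.
elim: n => [|n IH]; first by rewrite big_ord0 linear0.
rewrite big_ord_recr linearD linearZ/= eE.
rewrite -[LHS]/(seq_of (\sum_(i < n) a i *: e i) k + a n * (k == n)%:R) IH.
rewrite ltnS; case: ltngtP => kn; rewrite ?mulr0 ?addr0//.
by rewrite mulr1 add0r kn.
Qed.

Lemma seq_of_xpoly p : seq_of (xpoly p) = ps_of_poly p.
Proof.
apply/funext => k; rewrite /xpoly (seq_of_sum_basis (fun i => p`_i)) /ps_of_poly.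
by case: ltnP => // pk; rewrite nth_default.
Qed.

Lemma xpolyB p q : xpoly (p - q) = xpoly p - xpoly q.
Proof.
apply/seq_of_inj; rewrite linearB; apply/funext => k.
rewrite -[RHS]/(seq_of (xpoly p) k - seq_of (xpoly q) k) !seq_of_xpoly.
exact: coefB.
Qed.

Lemma xpolyD p q : xpoly (p + q) = xpoly p + xpoly q.
Proof.
apply/seq_of_inj; rewrite linearD; apply/funext => k.
rewrite -[RHS]/(seq_of (xpoly p) k + seq_of (xpoly q) k) !seq_of_xpoly.
exact: coefD.
Qed.

Lemma xpolyZ (a : R[i]) p : xpoly (a *: p) = a *: xpoly p.
Proof.
apply/seq_of_inj; rewrite linearZ; apply/funext => k.
rewrite -[RHS]/(a * seq_of (xpoly p) k) !seq_of_xpoly.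
exact: coefZ.
Qed.

Lemma xpolyXn n : xpoly 'X^n = e n.
Proof.
apply/seq_of_inj; rewrite seq_of_xpoly eE; apply/funext => k.
by rewrite /ps_of_poly coefXn.
Qed.

Lemma xpoly_poly n (a : nat -> R[i]) :
  xpoly (\poly_(i < n) a i) = \sum_(i < n) a i *: e i.
Proof.
apply/seq_of_inj/funext => k.
by rewrite seq_of_xpoly seq_of_sum_basis /ps_of_poly coef_poly; case: ifP.
Qed.

Lemma xmon_xpoly (u : nat -> {poly R[i]}) k : (1 < k)%N ->
  xmon (xpoly \o u) k = xpoly (mon u k).
Proof.
move=> k1; apply/seq_of_inj; rewrite seq_of_xmon// seq_of_xpoly rmorph_mon.
apply: (congr1 (fun v : nat -> fps R => mon v k)).
by apply/funext => p /=; rewrite seq_of_xpoly.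
Qed.

(** Convergence in [X] is coordinatewise, so the coefficients of the expansion can only be the
    coordinates of [x]. *)
Lemma basis_expansion x q (d : R) : 0 < d ->
  exists n0, forall n, (n0 <= n)%N ->
    sn q (xpoly (\poly_(i < n) seq_of x i) - x) < d.
Proof.
move=> d0; have [a [ax _]] := basis_e x.
have aE : a = seq_of x.
  apply/funext => k; have [_ _ coord] := frechetX.
  have /= := coord _ _ ax k.
  have ak : (fun n => seq_of (series (fun n => a n *: e n) n) k) @ \oo -->
      (a k : R[i]^o).
    apply: (@cvg_trans _ ((fun=> a k : R[i]^o) @ \oo)); last exact: cvg_cst.
    apply: near_eq_cvg; exists k.+1 => // n /= kn.
    by rewrite /series/= big_mkord seq_of_sum_basis kn.
  by move=> h; apply: cvg_unique ak h; exact: norm_hausdorff.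
have /cvg_snP/(_ q d d0)[n0 n0P] := ax.
exists n0 => n n0n; have := n0P n n0n.
by rewrite /series/= big_mkord xpoly_poly aE.
Qed.

(** Each term is the difference of two consecutive partial sums. *)
Lemma basis_terms_cvg0 x q (d : R) : 0 < d ->
  exists n0, forall n, (n0 <= n)%N -> normc (seq_of x n) * sn q (e n) < d.
Proof.
move=> d0; have d20 : 0 < d / 2 by rewrite divr_gt0.
have [n0 n0P] := basis_expansion x q d20.
exists n0 => n n0n; rewrite -snZ.
rewrite (_ : _ *: _ = (xpoly (\poly_(i < n.+1) seq_of x i) - x) -
    (xpoly (\poly_(i < n) seq_of x i) - x)); last first.
  by rewrite opprB addrA subrK !xpoly_poly big_ord_recr/= addrAC subrr add0r.
apply: (le_lt_trans (snD _ _ _)); rewrite snN (splitr d).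
by rewrite ltrD// n0P// (leq_trans n0n).
Qed.

End Basis.

(** * Perturbing finitely supported sequences *)

Section Iterates.
Context (R : realType) (X : seqAlgebra R) (T : {linear X -> X}).

Lemma iter_linear N : linear (iter N T).
Proof.
by elim: N => // N IH c x y; rewrite !iterS IH linearP.
Qed.

HB.instance Definition _ N :=
  GRing.isLinear.Build R[i] X X *:%R (iter N T) (iter_linear N).

Lemma iter_sn_le N : continuous T ->
  forall r, exists q, exists2 c : R, 0 < c & forall x, sn r (iter N T x) <= c * sn q x.
Proof.
move=> cT; elim: N => [|N IH] r.
  by exists r, 1 => // x; rewrite mul1r.
have [q1 [c1 c10 h1]] := continuous_sn_le cT r.
have [q2 [c2 c20 h2]] := IH q1.
exists q2, (c1 * c2); first exact: mulr_gt0.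
by move=> x; rewrite iterS (le_trans (h1 _))// -mulrA ler_pM2l.
Qed.

End Iterates.

Lemma weight_gt0 (a : nat -> nat) : (forall i, 0 < a i)%N ->
  forall k, (1 < k)%N -> (0 < weight a k)%N.
Proof.
move=> a0; apply: prime_mul_ind => [p pp|k l k1 l1 k0 l0].
  by rewrite weight_prime.
by rewrite weightM ?(ltnW k1) ?(ltnW l1)// addn_gt0 k0.
Qed.

Section Shift.
Context (R : realType) (X : seqAlgebra R) (frechetX : is_frechet_seq_algebra X).
Context (e : nat -> X) (eE : forall n, e n = unit_seq R n :> omega R).
Hypothesis basis_e : is_schauder_basis e.
Hypothesis continuous_normX : admits_continuous_norm X.
Hypothesis supmulX : forall r : nat, exists q : nat, exists2 c : R, 0 < c &
  forall n k, seminorm X r (unit_seq R n) * seminorm X r (unit_seq R k)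
    <= c * seminorm X q (unit_seq R (n + k)).
Context (w : nat -> R[i]) (w_neq0 : forall n, (1 <= n)%N -> w n != 0).
Context (T : {linear X -> X}) (shiftT : is_bounded_weighted_shift w T).
Implicit Types (p : {poly R[i]}) (x y : X).

Definition wprod n : R[i] := \prod_(j < n) w j.+1.

Lemma wprod_neq0 n : wprod n != 0.
Proof. by apply/prodf_neq0 => j _; exact: w_neq0. Qed.

Lemma wprodS n : wprod n.+1 = wprod n * w n.+1.
Proof. exact: big_ord_recr. Qed.

Lemma iter_shiftE N x l :
  seq_of (iter N T x) l = wprod (N + l) / wprod l * seq_of x (N + l)%N.
Proof.
elim: N l => [|N IH] l; first by rewrite divff ?wprod_neq0// mul1r.
have [TE _] := shiftT.
rewrite iterS TE /weighted_shift IH wprodS addnS addSn.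
by field; rewrite wprod_neq0 w_neq0.
Qed.

Lemma seq_of_basis n k : seq_of (e n) k = (k == n)%:R.
Proof. by rewrite eE. Qed.

Lemma basisM n k : e (n + k) = seqalg_mul (e n) (e k).
Proof.
apply/seq_of_inj; rewrite -[RHS]/(cauchy_prod (seq_of (e n)) (seq_of (e k))).
rewrite -!(xpolyXn eE) !(seq_of_xpoly eE) exprD.
exact: rmorphM (ps_of_poly (R := R)) _ _.
Qed.

(** A seminorm dominating a continuous norm cannot vanish at [e n]. *)
Lemma sn_basis_gt0 : exists q0, forall q n, 0 < sn (q0 + q) (e n).
Proof.
have [N [Nge0 N0 _ _] [q0 [c c0 Nc]]] := continuous_normX.
exists q0 => q n; apply: (@lt_le_trans _ _ (sn q0 (e n))); last first.
  by rewrite sn_mono// leq_addr.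
rewrite lt_neqAle sn_ge0 andbT eq_sym; apply/eqP => en0.
have : N (e n) = 0.
  by apply/le_anti; rewrite Nge0 andbT (le_trans (Nc _))// en0 mulr0.
move/N0 => en; have := seq_of_basis n n; rewrite en eqxx linear0 => /eqP.
by rewrite -[X in X == _]/(0 : R[i]) eq_sym oner_eq0.
Qed.

Lemma HC_small x : HC T x -> forall q (eta : R) n0, 0 < eta ->
  exists2 n, (n0 <= n)%N & sn q (e n) < eta * normc (wprod n).
Proof.
move=> /dense_snP hcx q eta n0 eta0.
have [n1 n1P] := basis_terms_cvg0 frechetX eE basis_e x q eta0.
pose n2 := maxn n0 n1.
(* [B] bounds the 0-th coordinates of the first [n2] iterates. An iterate whose 0-th coordinate is
   within 1 of [c] exceeds this bound, so it occurs at a time at least [n2]. *)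
pose B := \sum_(n < n2) normc (seq_of (iter n T x) 0%N).
have B0 : 0 <= B by apply: sumr_ge0 => n _; exact: normc_ge0.
pose c : R[i] := ((B + 2)%:C)%C.
(* Coordinates are controlled only along convergent sequences, hence a whole sequence of times
   rather than a single one. *)
have pick j : exists n, sn j (iter n T x - c *: e 0%N) < j.+1%:R^-1.
  have [|_ [n _ <-] h] := hcx (c *: e 0%N) j (j.+1%:R^-1); last by exists n.
  by rewrite invr_gt0.
have [N NP] := choice pick.
have [_ _ coord] := frechetX.
have : (fun j => iter (N j) T x) @ \oo --> c *: e 0%N.
  apply/cvg_snP => r d d0.
  exists (maxn r (Num.truncn d^-1)) => n; rewrite geq_max => /andP[rn dn].
  apply: (le_lt_trans (sn_mono _ rn)); apply: (lt_le_trans (NP n)).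
  rewrite -[leRHS]invrK lef_pV2 ?posrE ?invr_gt0// ltW//.
  by rewrite (lt_le_trans (truncnS_gt _))// ler_nat ltnS.
have c0E : seq_of (c *: e 0%N) 0%N = c.
  rewrite linearZ -[LHS]/(c * seq_of (e 0%N) 0%N) seq_of_basis.
  exact: mulr1.
move=> /coord/(_ 0%N); rewrite c0E => /cvgrPdist_lt/(_ 1 ltr01)[j _].
move=> /(_ j (leqnn _)) /=; rewrite (ltr_normC _ (1 : R)).
set y := seq_of _ _ => cy.
have yB : B + 1 < normc y.
  have : normc c <= normc (c - y) + normc y.
    rewrite -{1}[c](subrK y); exact: le_normcD.
  by rewrite normc_ge0_real; lra.
have n2N : (n2 <= N j)%N.
  rewrite leqNgt; apply/negP => jn2.
  have : normc y <= B.
    rewrite /B (bigD1 (Ordinal jn2))//= lerDl.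
    by apply: sumr_ge0 => n _; exact: normc_ge0.
  lra.
exists (N j); first by rewrite (leq_trans (leq_maxl _ _) n2N).
have y1 : 1 <= normc (wprod (N j)) * normc (seq_of x (N j)).
  rewrite -ComplexField.Normc.normcM.
  suff -> : wprod (N j) * seq_of x (N j) = y by lra.
  by rewrite /y iter_shiftE addn0 /wprod big_ord0 divr1.
have := n1P (N j) (leq_trans (leq_maxr _ _) n2N).
rewrite -(ltr_pM2l (normc_gt0 (wprod_neq0 (N j)))) [X in _ < X]mulrC.
by apply: le_lt_trans; rewrite mulrA ler_peMl ?sn_ge0.
Qed.

(** This is [exists_scale] for the seminorms of the [e n]; the offset [q0] makes them all
    positive. *)
Lemma exists_scale_basis : HC T !=set0 -> exists q0, forall M k J r (delta eta : R) s0,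
    (0 < M)%N -> (0 < k)%N -> 0 < delta <= 1 -> 0 < eta ->
  exists2 s, (s0 <= s)%N & exists2 t : R, 0 < t &
  [/\ t ^+ M * normc (wprod (s * M)%N) = delta, t * sn (q0 + r) (e s) < eta &
      forall i, (i <= J)%N ->
        normc (wprod (s * M)%N) / normc (wprod (s * M - i)%N) * t ^+ k *
          sn (q0 + r) (e (k * s - i)%N) < eta].
Proof.
move=> [x hcx]; have [q0 q0P] := sn_basis_gt0; exists q0.
have A0 n : 0 < normc (wprod n) by exact: normc_gt0 (wprod_neq0 n).
apply: (@exists_scale R (fun q n => sn (q0 + q) (e n)) (fun n => normc (wprod n))) => //.
- by move=> q r n qr; rewrite sn_mono// leq_add2l.
- by move=> q n k; rewrite basisM; exact: snM.
- move=> r; have [q [c c0 h]] := supmulX (q0 + r)%N.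
  exists q, c => // n k; have := h n k; rewrite -!eE => hnk; apply: (le_trans hnk).
  by rewrite ler_pM2l// sn_mono// leq_addl.
- move=> r; have [TE cT] := shiftT.
  have [q [c c0 h]] := continuous_sn_le cT (q0 + r)%N.
  exists q, c => // n; have := h (e n.+1).
  have -> : T (e n.+1) = w n.+1 *: e n.
    apply/seq_of_inj/funext => k; rewrite TE /weighted_shift seq_of_basis linearZ.
    rewrite -[RHS]/(w n.+1 * seq_of (e n) k) seq_of_basis eqSS.
    by case: eqVneq => [->//|_]; rewrite !mulr0.
  rewrite snZ wprodS ComplexField.Normc.normcM -mulrA => hn.
  rewrite [leRHS]mulrCA ler_pM2l//; apply: (le_trans hn).
  by rewrite ler_pM2l// sn_mono// leq_addl.
- by move=> q eta n0 eta0; exact: HC_small hcx _ _ _ eta0.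
Qed.

Lemma sn_xpolyXnM q p b n : (size p <= n)%N ->
  sn q (xpoly e ('X^b * p)) <= \sum_(i < n) normc p`_i * sn q (e (b + i)%N).
Proof.
move=> pn.
have -> : xpoly e ('X^b * p) = \sum_(i < n) p`_i *: e (b + i)%N.
  transitivity (\sum_(i < n) xpoly e (p`_i *: 'X^(b + i))).
    rewrite -(big_morph _ (xpolyD eE) (_ : xpoly e 0 = 0)); last first.
      by rewrite /xpoly size_poly0 big_ord0.
    congr xpoly; have {1}-> : p = \poly_(i < n) p`_i.
      apply/polyP => i; rewrite coef_poly; case: ltnP => // ni.
      by rewrite nth_default// (leq_trans pn).
    rewrite poly_def mulr_sumr; apply: eq_bigr => i _.
    by rewrite -scalerAr -exprD.
  by apply: eq_bigr => i _; rewrite (xpolyZ eE) (xpolyXn eE).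
apply: (le_trans (sn_sum _ _ _ _)); apply: ler_sum => i _.
by rewrite snZ.
Qed.

Lemma sn_basisX q s k : (0 < k)%N -> sn q (e (k * s)%N) <= sn q (e s) ^+ k.
Proof.
case: k => // k _; elim: k => [|k IH]; first by rewrite mul1n expr1.
rewrite mulSn exprS basisM (le_trans (snM _ _ _))//.
by rewrite ler_wpM2l// sn_ge0.
Qed.

(** * The perturbation and its effect on monomials *)

Section Perturbation.
Context (x : nat -> {poly R[i]}) (a : nat -> nat) (p0 : nat) (K H J s : nat).
Context (tau : R[i]) (D0 : {poly R[i]}).
Hypothesis a_gt0 : forall i, (0 < a i)%N.
Hypothesis p0_prime : prime p0.
Hypothesis tau_neq0 : tau != 0.
Hypothesis x_size : forall i, (i < K)%N -> (size (x i) <= H)%N.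
Hypothesis D0_size : (size D0 <= H)%N.
Hypothesis HJ : (2 * H <= J.+1)%N.
Hypothesis s_large : (J + H < s)%N.

(** The correction [D0] sits just below degree [a p0 * s], in the variable [p0] alone. Indices from
    [K] on are left alone, since monomials of index below [K] do not involve them. *)
Definition perturbation i : {poly R[i]} := if (i < K)%N then
  tau ^+ a i *: 'X^(a i * s) +
    (if i == p0 then 'X^(a p0 * s - J) * D0 else 0) else 0.

(** As with dual numbers, [D0] is multiplied by the partial derivative of the monomial in the
    variable [p0], taken at the points [tau ^+ a i]. *)
Lemma leading_mon k : (1 < k < K)%N ->
  leading J (weight a k * s) (tau ^+ weight a k)
    (((logn p0 k)%:R * tau ^+ weight a k / tau ^+ a p0) *: D0)
    (mon (fun i => x i + perturbation i) k).
Proof.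
case/andP=> k1; move: k k1; apply: prime_mul_ind => [p pp pK|k l k1 l1 IHk IHl klK].
  rewrite mon_prime// weight_prime// /perturbation pK /leading.
  have sa : (s <= a p * s)%N by rewrite leq_pmull.
  (* The original [x p] is negligible: ['X^J * x p] has size at most [J + H], which is less than
     [s]. *)
  rewrite (_ : _ - _ = 'X^J * x p).
    apply: (leq_trans (size_polyMleq _ _)); rewrite size_polyXn addSn/=.
    have := x_size pK; move: (size _) => m; lia.
  rewrite logn_prime// [p0 == p]eq_sym; case: eqVneq => [pp0|_].
    rewrite pp0 in sa *; rewrite mul1r divff ?expf_neq0// scale1r.
    have -> : 'X^(a p0 * s) = 'X^J * 'X^(a p0 * s - J) :> {poly R[i]}.
      by rewrite -exprD subnKC//; apply: leq_trans sa; lia.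
    by rewrite -!mul_polyC; ring.
  rewrite mul0r mul0r scale0r !addr0 -!mul_polyC; ring.
have k0 := ltnW k1; have l0 := ltnW l1.
have kK : (k < K)%N by apply: leq_ltn_trans klK; rewrite leq_pmulr.
have lK : (l < K)%N by apply: leq_ltn_trans klK; rewrite leq_pmull.
have sD c : (size (c *: D0)%R <= H)%N by exact: leq_trans (size_scale_leq _ _) D0_size.
have := leadingM HJ (sD _) (sD _) (IHk kK) (IHl lK).
rewrite monM// weightM// -mulnDl -exprD lognM// !scalerA -scalerDl.
congr (leading _ _ _ (_ *: _) _); rewrite natrD exprD; field.
by rewrite expf_neq0.
Qed.

Lemma sn_perturbation_le q i : sn q (xpoly e (perturbation i)) <=
  (normc tau * sn q (e s)) ^+ a i +
    \sum_(l < H) normc D0`_l * sn q (e (a p0 * s - J + l)%N).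
Proof.
have sum_ge0 : 0 <= \sum_(l < H) normc D0`_l * sn q (e (a p0 * s - J + l)%N).
  by apply: sumr_ge0 => l _; rewrite mulr_ge0 ?normc_ge0 ?sn_ge0.
have xpoly0 : xpoly e 0 = 0 by rewrite /xpoly size_poly0 big_ord0.
rewrite /perturbation; case: ifP => _; last first.
  rewrite xpoly0 sn0 addr_ge0// exprn_ge0// mulr_ge0 ?normc_ge0 ?sn_ge0//.
rewrite (xpolyD eE) (le_trans (snD _ _ _))// lerD//.
  rewrite (xpolyZ eE) (xpolyXn eE) snZ normcX exprMn ler_wpM2l//.
    by rewrite exprn_ge0// normc_ge0.
  exact: sn_basisX.
by case: ifP => _; [exact: sn_xpolyXnM|rewrite xpoly0 sn0].
Qed.

End Perturbation.

Lemma exists_perturbation (x : nat -> {poly R[i]}) (a : nat -> nat) b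
    (v : {poly R[i]}) K q (d : R) : HC T !=set0 ->
    (forall i, 0 < a i)%N -> (1 < b)%N -> 0 < d ->
  exists u : nat -> {poly R[i]}, exists N : nat,
  [/\ forall i, sn q (xpoly e (u i) - xpoly e (x i)) < d,
      sn q (iter N T (xpoly e (mon u b)) - xpoly e v) < d &
      forall k, (1 < k < K)%N -> (weight a k < weight a b)%N ->
        iter N T (xpoly e (mon u k)) = 0].
Proof.
move=> /exists_scale_basis[q0 scale] a0 b1 d0.
pose K' := maxn K b.+1.
pose H := maxn (size v) (\max_(i < K') size (x i)).
pose J := (2 * H).+1.
pose p0 := pdiv b; pose m := logn p0 b; pose M := weight a b.
have p0p : prime p0 by exact: pdiv_prime.
have m0 : (0 < m)%N by rewrite logn_gt0 pi_pdiv.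
have M0 : (0 < M)%N by exact: weight_gt0.
have A0 n : 0 < normc (wprod n) by exact: normc_gt0 (wprod_neq0 n).
(* The top term of the monomial is sent by the iterate to a multiple of [e J] of seminorm
   [delta * C]; [delta] makes this smaller than [d]. *)
pose C := sn (q0 + q) (e J) / normc (wprod J).
have C0 : 0 <= C by rewrite divr_ge0 ?sn_ge0 ?normc_ge0.
pose delta := Num.min 1 (d / (C + 1)).
have delta0 : 0 < delta by rewrite lt_min ltr01 divr_gt0// ltr_wpDl.
have delta1 : 0 < delta <= 1 by rewrite delta0 ge_min lexx.
have deltaC : delta * C < d.
  apply: (@le_lt_trans _ _ (d / (C + 1) * C)).
    by rewrite ler_wpM2r// ge_min lexx orbT.
  by rewrite mulrAC ltr_pdivrMr ?ltr_wpDl// ltr_pM2l// ltrDl.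
pose S := \sum_(l < H) normc (v`_l * wprod l).
have S0 : 0 <= S by apply: sumr_ge0 => l _; exact: normc_ge0.
(* The first bound makes [tau *: e s] small; the second gives [S * (eta / delta) <= d / 2], which
   controls the contribution of [D0]. *)
pose eta := Num.min (Num.min 1 (d / 2)) (d / 2 * delta / (S + 1)).
have eta0 : 0 < eta.
  by rewrite !lt_min ltr01 !divr_gt0 ?mulr_gt0 ?divr_gt0// ltr_wpDl.
have [s sJH [t t0 [tA tE tJ]]] :=
  scale M (a p0) J q delta eta (J + H).+1 M0 (a0 p0) delta1 eta0.
pose n := (s * M)%N; pose N := (n - J)%N.
have Jn : (J <= n)%N.
  by rewrite (leq_trans _ (leq_pmulr _ M0))// (leq_trans _ sJH)// leqW// leq_addr.
pose tau : R[i] := (t%:C)%C.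
have ntau : normc tau = t by rewrite normc_ge0_real// ltW.
have tau0 : tau != 0.
  by apply: contra_neq (lt0r_neq0 t0) => t00; rewrite -ntau t00 ComplexField.Normc.normc0.
have HJ1 : (H <= J)%N by rewrite /J leqW// leq_pmull.
(* The coefficients solve the linear equation which makes the part of the iterate linear in [D0]
   equal to [v]: they undo the weights, the exponent [m] and the powers of [tau]. *)
pose D0 := \poly_(l < H)
  (v`_l * wprod l / wprod (N + l) / m%:R / tau ^+ M * tau ^+ a p0).
pose y := perturbation a p0 K' J s tau D0.
have D0H : (size D0 <= H)%N by exact: size_poly.
have HJ : (2 * H <= J.+1)%N by rewrite /J !leqW.
have xH i : (i < K')%N -> (size (x i) <= H)%N.
  move=> iK; rewrite (leq_trans _ (leq_maxr _ _))//.
  exact: (@leq_bigmax _ (fun i : 'I_K' => size (x i)) (Ordinal iK)).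
have lead k : (1 < k < K')%N -> leading J (weight a k * s) (tau ^+ weight a k)
    (((logn p0 k)%:R * tau ^+ weight a k / tau ^+ a p0) *: D0)
    (mon (fun i => x i + y i) k).
  by move=> kK; apply: (leading_mon a0 p0p tau0 xH D0H HJ sJH kK).
have mC : m%:R != 0 :> R[i] by rewrite pnatr_eq0 -lt0n.
have D0E l : (l < H)%N -> (N + l = n - (J - l))%N.
  by move=> lH; rewrite subnA// (leq_trans (ltnW lH) HJ1).
have tM : t ^+ M = delta / normc (wprod n) by rewrite -tA mulfK// gt_eqF.
have nm : normc (m%:R : R[i]) = m%:R.
  by rewrite -(rmorph_nat (real_complex R)) normc_ge0_real.
exists (fun i => x i + y i), N; split.
- move=> i; rewrite -(xpolyB eE) addrC addKr.
  apply: (le_lt_trans (sn_mono _ (leq_addl q0 q))).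
  apply: (le_lt_trans (@sn_perturbation_le a p0 K' H J s tau D0 a0 D0H (q0 + q)%N i)).
  rewrite ntau (splitr d); apply: ltr_leD.
    apply: (@le_lt_trans _ _ (t * sn (q0 + q) (e s))).
      have := tE; rewrite !lt_min => /andP[/andP[h1 _] _].
      have tE0 : 0 <= t * sn (q0 + q) (e s)
        by rewrite mulr_ge0 ?sn_ge0// ltW.
      case: (a i) (a0 i) => // k _; rewrite exprS ler_piMr// exprn_ile1//.
      exact: ltW.
    by have := tE; rewrite !lt_min => /andP[/andP[]].
  apply: (@le_trans _ _ (\sum_(l < H) normc (v`_l * wprod l) * (eta / delta))).
    apply: ler_sum => l _; rewrite coef_poly ltn_ord.
    rewrite 4!ComplexField.Normc.normcM !ComplexField.Normc.normcV !normcX.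
    rewrite ntau nm tM; set g := normc (_ * _).
    have lH := ltn_ord l.
    have h := ltW (tJ (J - l)%N (leq_subr _ _)).
    have -> : (a p0 * s - J + l = a p0 * s - (J - l))%N.
      rewrite subnA ?(leq_trans (ltnW lH) HJ1)//.
      by rewrite (leq_trans _ (leq_pmull _ _))// (leq_trans _ sJH)// leqW// leq_addr.
    rewrite D0E//; set E := sn _ _ in h *.
    have m1 : 1 <= m%:R :> R by rewrite ler1n.
    have g0 : 0 <= g by exact: normc_ge0.
    apply: (@le_trans _ _ (g / m%:R / delta * eta)); last first.
      rewrite mulrAC -!mulrA ler_wpM2l// mulrCA ler_wpM2l ?(ltW eta0)//.
      rewrite ler_piMl ?invr_ge0 ?(ltW delta0)//.
      by rewrite invf_le1// (lt_le_trans ltr01).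
    apply: le_trans (ler_wpM2l _ h); last first.
      by rewrite !divr_ge0// ltW.
    rewrite le_eqVlt; apply/orP; left; apply/eqP; rewrite -/n.
    field; rewrite !gt_eqF//.
    by rewrite (lt_le_trans ltr01).
  rewrite -mulr_suml -/S.
  have : eta / delta <= d / 2 / (S + 1).
    by rewrite ler_pdivrMr// mulrAC ge_min lexx orbT.
  move=> /(ler_wpM2l S0)/le_trans; apply.
  rewrite mulrA ler_pdivrMr ?ltr_wpDl//; nra.
- have bK : (1 < b < K')%N by rewrite b1/= leq_maxr.
  have Jw : (J <= weight a b * s)%N by rewrite mulnC.
  (* The linear part cancels [v], and the error is exactly the image of the top term. *)
  rewrite (_ : _ - _ = (wprod n / wprod J * tau ^+ M) *: e J); last first.
    apply/seq_of_inj/funext => l; rewrite linearB linearZ.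
    rewrite -[LHS]/(seq_of (iter N T (xpoly e (mon (fun i => x i + y i) b))) l -
      seq_of (xpoly e v) l).
    rewrite -[RHS]/(wprod n / wprod J * tau ^+ M * seq_of (e J) l).
    rewrite iter_shiftE !(seq_of_xpoly eE) seq_of_basis /ps_of_poly.
    have := leading_coef l Jw (lead b bK); rewrite mulnC -/n -/N => ->.
    rewrite coefZ coef_poly -/M -/m; case: ltnP => lH.
      have lJ : (l == J) = false by rewrite ltn_eqF// (leq_trans lH).
      rewrite lJ !mulr0 add0r; field.
      by rewrite !wprod_neq0 mC !expf_neq0.
    have -> : v`_l = 0 by rewrite nth_default// (leq_trans (leq_maxl _ _) lH).
    rewrite mulr0 addr0 subr0; case: eqVneq => [->|_]; last by rewrite !mulr0.
    by rewrite /N subnK// !mulr1.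
  apply: (le_lt_trans (sn_mono _ (leq_addl q0 q))).
  rewrite snZ !ComplexField.Normc.normcM ComplexField.Normc.normcV normcX ntau tM.
  apply: le_lt_trans deltaC.
  rewrite le_eqVlt; apply/orP; left; apply/eqP; rewrite /C.
  by field; rewrite !gt_eqF.
(* A smaller weight is smaller by at least one, so the degree drops by at least [s > J] below [n]
   and the monomial is supported below [N = n - J]. *)
- move=> k /andP[k1 kK] kb; apply/seq_of_inj/funext => l.
  rewrite iter_shiftE (seq_of_xpoly eE) linear0 /ps_of_poly nth_default ?mulr0//.
  have kK' : (1 < k < K')%N by rewrite k1 (leq_trans kK)// leq_maxl.
  apply: (leq_trans (leading_size HJ _ (lead _ kK'))).
    by rewrite (leq_trans (size_scale_leq _ _)).
  have : (weight a k * s + s <= n)%N by rewrite addnC -mulSn /n mulnC leq_mul.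
  move=> ksn; apply: leq_trans (leq_addr _ _); rewrite /N ltn_subRL addnC.
  apply: leq_trans ksn; rewrite ltn_add2l (leq_trans _ sJH)// ltnS leq_addr//.
Qed.

End Shift.

(** * A Baire argument *)

Section Baire.
Context (R : realType) (X : seqAlgebra R) (frechetX : is_frechet_seq_algebra X).
Context (V : Type) (f : V -> X) (v0 : V).

(** A basic neighbourhood in the product of countably many copies of [X], with [q] bounding both
    coordinates and seminorm. It is closed, so that limits stay inside. *)
Definition sn_ball (c : nat -> V) q (d : R) : set (nat -> X) :=
  [set z | forall j, (j <= q)%N -> sn q (z j - f (c j)) <= d].

Lemma sn_ball_center c q d : 0 < d -> sn_ball c q d (f \o c).
Proof. by move=> d0 j _ /=; rewrite subrr sn0 ltW. Qed.

Lemma inv_succ_lt (d : R) : 0 < d -> exists n, forall m, (n <= m)%N -> m.+1%:R^-1 < d.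
Proof.
move=> d0; exists (Num.truncn d^-1) => m nm.
rewrite -[ltRHS]invrK ltf_pV2 ?posrE ?invr_gt0//.
by rewrite (lt_le_trans (truncnS_gt _))// ler_nat ltnS.
Qed.

(** Nested closed balls are built one condition at a time; their centres converge in each coordinate
    by completeness. *)
Lemma baire_sequences (I : countType) (O : I -> set (nat -> X)) :
    (forall i c q (d : R), 0 < d -> exists c', exists q', exists2 d' : R, 0 < d' &
      (forall j, (j <= q)%N -> sn q (f (c' j) - f (c j)) < d) /\
      sn_ball c' q' d' `<=` O i) ->
  exists z, forall i, O i z.
Proof.
move=> dO.
pose ball (s : (nat -> V) * nat * R) := sn_ball s.1.1 s.1.2 s.2.
(* Stage [n] treats the condition with code [n], if any. Positivity of the radius is a premise
   inside the existential, so that a choice function can be extracted. *)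
have step (ns : nat * ((nat -> V) * nat * R)) : exists s' : (nat -> V) * nat * R,
    0 < ns.2.2 -> [/\ 0 < s'.2, s'.2 <= ns.1.+1%:R^-1, (ns.1 <= s'.1.2)%N,
      ball s' `<=` ball ns.2 &
      forall i, unpickle ns.1 = Some i -> ball s' `<=` O i].
  case: ns => n [[c q] d] /=; have [d0|] := ltP 0 d; last by exists (c, q, d).
  have [c' [q' [d' d'0 [cc' h]]]] : exists c', exists q', exists2 d' : R, 0 < d' &
      (forall j, (j <= q)%N -> sn q (f (c' j) - f (c j)) < d / 2) /\
      forall i, unpickle n = Some i -> sn_ball c' q' d' `<=` O i.
    have d20 : 0 < d / 2 by rewrite divr_gt0.
    case ni : (unpickle n) => [i|].
      have [c' [q' [d' d'0 [cc' h]]]] := dO i c q _ d20.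
      by exists c', q', d' => //; split => // _ [<-].
    by exists c, q, d => //; split=> [j _|i]; [rewrite subrr sn0|].
  exists (c', maxn (maxn q q') n, Num.min (Num.min (d / 2) d') n.+1%:R^-1) => _.
  split => //=.
  - by rewrite !lt_min d'0 divr_gt0//= invr_gt0 ltr0n.
  - by rewrite ge_min lexx orbT.
  - by rewrite leq_maxr.
  - move=> z zs j jq; rewrite (le_trans (snB_triangle _ _ (f (c' j)) _))//.
    rewrite (splitr d) lerD// ?(ltW (cc' _ jq))//.
    have := zs j; rewrite /= !leq_max jq => /(_ isT).
    rewrite !le_min => /andP[/andP[+ _] _]; apply: le_trans.
    by rewrite sn_mono// !leq_max leqnn.
  - move=> i ni z zs; apply: h ni _ _ => j jq.
    have := zs j; rewrite /= !leq_max jq orbT => /(_ isT).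
    rewrite !le_min => /andP[/andP[_ +] _]; apply: le_trans.
    by rewrite sn_mono// !leq_max leqnn orbT.
have [F FP] := choice step.
pose s := fix s n := if n is m.+1 then F (m, s m) else ((fun=> v0), 0%N, 1).
have s_gt0 n : 0 < (s n).2.
  by elim: n => [|n IH] //=; have [] := FP (n, s n) IH.
have sS n := FP (n, s n) (s_gt0 n).
have nested n k : ball (s (n + k)%N) `<=` ball (s n).
  elim: k => [|k IH]; first by rewrite addn0.
  by rewrite addnS; have [_ _ _ h _] := sS (n + k)%N; exact: subset_trans h IH.
pose c n := (s n).1.1.
have cP n m : (n <= m)%N -> ball (s n) (f \o c m).
  by move=> nm; apply: (nested n (m - n)%N); rewrite subnKC//; exact: sn_ball_center.
have cauchy_c j q d : 0 < d -> exists n, forall m m', (n <= m)%N -> (n <= m')%N ->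
    sn q (f (c m j) - f (c m' j)) < d.
  move=> d0; have d20 : 0 < d / 2 by rewrite divr_gt0.
  have [n nP] := inv_succ_lt d20.
  (* A ball only controls the coordinates and seminorms up to its index, so the stage must also
     exceed [j] and [q]. *)
  pose k := maxn n (maxn j q).
  exists k.+1; move=> m m' km km'.
  have [_ sk kq _ _] := sS k.
  have close l : (k < l)%N -> sn q (f (c l j) - f (c k.+1 j)) < d / 2.
    move=> kl; have jk : (j <= (s k.+1).1.2)%N.
      by rewrite (leq_trans _ kq)// !leq_max leqnn orbT.
    apply: le_lt_trans (nP k (leq_maxl _ _)); apply: le_trans sk.
    apply: le_trans (cP _ _ kl j jk); rewrite sn_mono// (leq_trans _ kq)//.
    by rewrite !leq_max leqnn !orbT.
  apply: (le_lt_trans (snB_triangle _ _ (f (c k.+1 j)) _)).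
  by rewrite (splitr d) ltrD ?close// snBC close.
have [z zP] := choice (fun j => complete_sn frechetX (cauchy_c j)).
exists z => i; have [_ _ _ _ /(_ i (pickleK i))] := sS (pickle i); apply.
move=> j jq; apply/ler_addgt0Pr => d d0; set n := (pickle i).+1 in jq *.
have [m0 m0P] := (cvg_snP _ _).1 (zP j) (s n).1.2 d d0.
pose m := maxn m0 n.
apply: (le_trans (snB_triangle _ _ (f (c m j)) _)); rewrite addrC lerD//.
  by apply: (cP n m _ j jq); rewrite leq_maxr.
by rewrite snBC ltW// m0P// leq_maxl.
Qed.

End Baire.

(** * The dense sequence of generators *)

Section Generators.
Context (R : realType) (X : seqAlgebra R) (frechetX : is_frechet_seq_algebra X).
Context (e : nat -> X) (eE : forall n, e n = unit_seq R n :> omega R).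
Hypothesis basis_e : is_schauder_basis e.
Hypothesis continuous_normX : admits_continuous_norm X.
Hypothesis supmulX : forall r : nat, exists q : nat, exists2 c : R, 0 < c &
  forall n k, seminorm X r (unit_seq R n) * seminorm X r (unit_seq R k)
    <= c * seminorm X q (unit_seq R (n + k)).
Context (w : nat -> R[i]) (w_neq0 : forall n, (1 <= n)%N -> w n != 0).
Context (T : {linear X -> X}) (shiftT : is_bounded_weighted_shift w T).

Lemma iter_xmon_continuous N (u : nat -> X) r (d : R) K : 0 < d ->
  exists q, exists2 d' : R, 0 < d' & forall z : nat -> X,
    (forall j, (j <= q)%N -> sn q (z j - u j) <= d') ->
    forall k, (1 < k < K)%N ->
      sn r (iter N T (xmon z k) - iter N T (xmon u k)) < d.
Proof.
move=> d0; elim: K => [|K [q1 [d1 d10 h1]]].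
  by exists 0%N, 1 => // z _ k; rewrite ltn0 andbF.
have [K1|K1] := leqP K 1.
  exists q1, d1 => // z zu k /andP[k1 kK].
  by move: kK; rewrite ltnS => /leq_trans/(_ K1); rewrite leqNgt k1.
have [_ cT] := shiftT.
have [q2 [c c0 h2]] := iter_sn_le N cT r.
have [q3 [d3 d30 h3]] := xmon_continuous u K1 q2 (divr_gt0 d0 c0).
exists (maxn q1 q3), (Num.min d1 d3); first by rewrite lt_min d10.
move=> z zu k /andP[k1]; rewrite ltnS leq_eqVlt => /predU1P[->|kK].
  rewrite -linearB (le_lt_trans (h2 _))// mulrC -ltr_pdivlMr//.
  apply: h3 => j jq; have := zu j (leq_trans jq (leq_maxr _ _)).
  by rewrite le_min => /andP[_]; apply: le_trans; rewrite sn_mono// leq_maxr.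
apply: h1; last by rewrite k1.
move=> j jq; have := zu j (leq_trans jq (leq_maxl _ _)).
by rewrite le_min => /andP[+ _]; apply: le_trans; rewrite sn_mono// leq_maxl.
Qed.

Lemma exists_generators : HC T !=set0 -> exists z : nat -> X,
  (forall y q (d : R), 0 < d -> exists2 p, prime p & sn q (z p - y) < d) /\
  (forall B b y q (d : R), (1 < b)%N -> 0 < d -> exists N,
    sn q (iter N T (xmon z b) - y) < d /\
    forall k, (1 < k < B)%N -> (weight (expn B.+1) k < weight (expn B.+1) b)%N ->
      sn q (iter N T (xmon z k)) < d).
Proof.
move=> HC0; have [x0 /dense_snP hx0] := HC0.
(* Truncating the iterates of a hypercyclic vector gives a countable dense family of finitely
   supported targets. *)
pose v n m : {poly R[i]} := \poly_(i < m) seq_of (iter n T x0) i.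
have v_dense y q d : 0 < d -> exists n m, sn q (xpoly e (v n m) - y) < d.
  move=> d0; have d20 : 0 < d / 2 by rewrite divr_gt0.
  have [_ [n _ <-] hn] := hx0 y q _ d20.
  have [m mP] := basis_expansion frechetX eE basis_e (iter n T x0) q d20.
  exists n, m; apply: (le_lt_trans (snB_triangle _ _ (iter n T x0) _)).
  by rewrite (splitr d) ltrD// mP.
(* Countably many conditions: the [inl] ones make the [z p] with [p] prime dense, the [inr] ones
   make the monomials hit all targets. *)
pose O (i : (nat * nat * nat) + (nat * nat * nat * nat * nat)) : set (nat -> X) :=
  match i with
  | inl (n, m, r) => [set z | exists2 p, prime p &
      sn r (z p - xpoly e (v n m)) < r.+1%:R^-1]
  | inr (n, m, r, B, b) => [set z | (1 < b)%N -> exists N,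
      sn r (iter N T (xmon z b) - xpoly e (v n m)) < r.+1%:R^-1 /\
      forall k, (1 < k < B)%N -> (weight (expn B.+1) k < weight (expn B.+1) b)%N ->
        sn r (iter N T (xmon z k)) < r.+1%:R^-1]
  end.
have [z zO] : exists z, forall i, O i z.
  apply: (baire_sequences frechetX (f := xpoly e) 0).
  case=> [[[n m] r]|[[[[n m] r] B] b]] u q d d0.
    (* The target is placed at a prime index beyond [q], where the given ball imposes nothing. *)
    have [p qp pp] := prime_above q.
    exists (fun j => if j == p then v n m else u j), (maxn p r), (r.+1%:R^-1 / 2).
      by rewrite divr_gt0// invr_gt0.
    split=> [j jq|z zu /=].
      by rewrite ltn_eqF ?subrr ?sn0// (leq_ltn_trans jq).
    exists p => //; apply: (@le_lt_trans _ _ (r.+1%:R^-1 / 2)).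
      have := zu p (leq_maxl _ _); rewrite eqxx; apply: le_trans.
      by rewrite sn_mono// leq_maxr.
    by rewrite ltr_pdivrMr// ltr_pMr ?invr_gt0// ltr1n.
  have [b1|b1] := ltnP 1 b; last first.
    exists u, 0%N, 1 => //; split=> [j jq|z _]; first by rewrite subrr sn0.
    by rewrite /= ltnNge b1.
  set h : R := r.+1%:R^-1; have h0 : 0 < h by rewrite invr_gt0.
  have h20 : 0 < h / 2 by rewrite divr_gt0.
  have dh : 0 < Num.min d (h / 2) by rewrite lt_min d0.
  have B0 i : (0 < B.+1 ^ i)%N by rewrite expn_gt0.
  have [u' [N [u'u u'b u'k]]] := exists_perturbation frechetX eE basis_e
    continuous_normX supmulX w_neq0 shiftT u (v n m) B (maxn q r) HC0 B0 b1 dh.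
  have [q' [d' d'0 h']] := iter_xmon_continuous N (xpoly e \o u') r (maxn B b.+1) h20.
  exists u', q', d' => //; split=> [j jq|z zu' /= _].
    have := u'u j; rewrite lt_min => /andP[+ _]; apply: le_lt_trans.
    by rewrite sn_mono// leq_maxl.
  exists N; split.
    apply: (le_lt_trans (snB_triangle _ _ (iter N T (xmon (xpoly e \o u') b)) _)).
    rewrite -/h (splitr h) ltrD// ?h' ?b1 ?leq_maxr//.
    rewrite (xmon_xpoly eE)//; move: u'b; rewrite lt_min => /andP[_].
    by apply: le_lt_trans; rewrite sn_mono// leq_maxr.
  move=> k /andP[k1 kB] kb; have kB' : (1 < k < maxn B b.+1)%N.
    by rewrite k1 leq_max kB.
  have := h' z zu' k kB'; rewrite (xmon_xpoly eE)// u'k ?k1// subr0 => /lt_trans.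
  by apply; rewrite ltr_pdivrMr// ltr_pMr// ltr1n.
exists z; split=> [y q d d0|B b y q d b1 d0];
  have d20 : 0 < d / 2 by [rewrite divr_gt0|rewrite divr_gt0].
  have [r0 r0P] := inv_succ_lt d20; pose r := maxn q r0.
  have [n [m nm]] := v_dense y q _ d20.
  have [p pp zp] := zO (inl (n, m, r)); exists p => //.
  apply: (le_lt_trans (snB_triangle _ _ (xpoly e (v n m)) _)).
  rewrite (splitr d) ltrD// (le_lt_trans (sn_mono _ (leq_maxl q r0)))//.
  by rewrite (lt_trans zp)// r0P// leq_maxr.
have [r0 r0P] := inv_succ_lt d20; pose r := maxn q r0.
have [n [m nm]] := v_dense y q _ d20.
have [N [Nb Nk]] := zO (inr (n, m, r, B, b)) b1.
have rd : r.+1%:R^-1 < d / 2 by rewrite r0P// leq_maxr.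
exists N; split=> [|k kB kb].
  apply: (le_lt_trans (snB_triangle _ _ (xpoly e (v n m)) _)).
  rewrite (splitr d) ltrD// (le_lt_trans (sn_mono _ (leq_maxl q r0)))//.
  exact: lt_trans Nb rd.
apply: (le_lt_trans (sn_mono _ (leq_maxl q r0))).
apply: (lt_trans (Nk k kB kb)); apply: (lt_trans rd).
by rewrite ltr_pdivrMr// ltr_pMr// ltr1n.
Qed.

End Generators.

(** * The hypercyclic algebra *)

Section MonomialSpan.
Context (R : realType) (X : seqAlgebra R) (z : nat -> X).
Implicit Types (Q : pred nat) (x y : X).

(** For [Q k] equal to [1 < k] these are the polynomials in the [z p], [p] prime, without constant
    term; excluding the multiples of a prime removes a variable. *)
Definition mon_span Q : set X := [set y | exists K (c : nat -> R[i]),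
  y = \sum_(k < K | Q k) c k *: xmon z k].

Lemma mon_span0 Q : mon_span Q 0.
Proof. by exists 0%N, (fun=> 0); rewrite big_ord0. Qed.

Lemma mon_span_mon Q k : Q k -> mon_span Q (xmon z k).
Proof.
move=> Qk; exists k.+1, (fun j => (j == k)%:R).
rewrite (bigD1 (ord_max : 'I_k.+1))//= eqxx scale1r big1 ?addr0// => j /andP[_ jk].
by rewrite (_ : (j == k :> nat) = false) ?scale0r//; exact: negbTE jk.
Qed.

Lemma mon_sum_widen Q K K' (c : nat -> R[i]) : (K <= K')%N ->
  \sum_(k < K | Q k) c k *: xmon z k =
  \sum_(k < K' | Q k) (if (k < K)%N then c k else 0) *: xmon z k.
Proof.
move=> KK'; rewrite (big_ord_widen_cond K' Q (fun k => c k *: xmon z k))//.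
rewrite big_mkcondr; apply: eq_bigr => k _.
by case: ifP => // _; rewrite scale0r.
Qed.

Lemma mon_spanD Q x y : mon_span Q x -> mon_span Q y -> mon_span Q (x + y).
Proof.
move=> [K [c ->]] [L [d ->]].
exists (maxn K L); exists (fun k => (if (k < K)%N then c k else 0) +
  (if (k < L)%N then d k else 0)).
rewrite (mon_sum_widen _ _ (leq_maxl K L)) (mon_sum_widen _ _ (leq_maxr K L)).
by rewrite -big_split; apply: eq_bigr => k _; rewrite scalerDl.
Qed.

Lemma mon_spanZ Q (a : R[i]) x : mon_span Q x -> mon_span Q (a *: x).
Proof.
move=> [K [c ->]]; exists K, (fun k => a * c k).
by rewrite scaler_sumr; apply: eq_bigr => k _; rewrite scalerA.
Qed.

Lemma seqalg_mulC x y : seqalg_mul x y = seqalg_mul y x.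
Proof. by apply/seq_of_inj; exact: ps_mulC. Qed.

Lemma seqalg_mul_suml I (s : seq I) (P : pred I) (c : I -> R[i]) (f : I -> X) y :
  seqalg_mul (\sum_(i <- s | P i) c i *: f i) y =
  \sum_(i <- s | P i) c i *: seqalg_mul (f i) y.
Proof.
have mul0 : seqalg_mul 0 y = 0 by have := seqalg_mulBl 0 0 y; rewrite !subrr.
have mulD a b : seqalg_mul (a + b) y = seqalg_mul a y + seqalg_mul b y.
  by have := seqalg_mulBl (a + b) b y; rewrite addrK => ->; rewrite subrK.
rewrite (big_morph (fun a => seqalg_mul a y) mulD mul0).
apply: eq_bigr => i _; apply/seq_of_inj.
rewrite -[LHS]/(cauchy_prod (seq_of (c i *: f i)) (seq_of y)) !linearZ.
exact: esym (@ps_scaleAl R (c i) (seq_of (f i)) (seq_of y)).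
Qed.

Lemma mon_spanM Q : (forall k, Q k -> 1 < k)%N ->
    (forall k l, Q k -> Q l -> Q (k * l)%N) ->
  forall x y, mon_span Q x -> mon_span Q y -> mon_span Q (seqalg_mul x y).
Proof.
move=> Q1 QM x y [K [c ->]] [L [d ->]].
rewrite seqalg_mul_suml; apply: big_ind => [|? ? ? ?|k Qk]; first exact: mon_span0.
  exact: mon_spanD.
apply: mon_spanZ; rewrite seqalg_mulC seqalg_mul_suml.
apply: big_ind => [|? ? ? ?|l Ql]; first exact: mon_span0.
  exact: mon_spanD.
apply: mon_spanZ; rewrite -xmonM ?Q1//; apply: mon_span_mon; exact: QM.
Qed.

Lemma mon_span_subalgebra Q : (forall k, Q k -> 1 < k)%N ->
    (forall k l, Q k -> Q l -> Q (k * l)%N) -> is_subalgebra (mon_span Q).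
Proof.
move=> Q1 QM; split; [exact: mon_span0|exact: mon_spanD|exact: mon_spanZ|].
exact: mon_spanM.
Qed.

End MonomialSpan.

Section HypercyclicSpan.
Context (R : realType) (X : seqAlgebra R) (T : {linear X -> X}) (z : nat -> X).
Hypothesis z_orbits : forall B b y q (d : R), (1 < b)%N -> 0 < d -> exists N,
    sn q (iter N T (xmon z b) - y) < d /\
    forall k, (1 < k < B)%N -> (weight (expn B.+1) k < weight (expn B.+1) b)%N ->
      sn q (iter N T (xmon z k)) < d.

(* The weights [K.+1 ^ p] separate the indices [k < K]; along suitable iterates
   the monomial of largest weight [b] approximates [y / c b] and all the others
   become negligible. *)
Lemma HC_mon_sum K (c : nat -> R[i]) k0 : (1 < k0 < K)%N -> c k0 != 0 ->
  HC T (\sum_(k < K | (1 < k)%N) c k *: xmon z k).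
Proof.
move=> /andP[k01 k0K] ck0.
pose F (k : 'I_K) := weight (expn K.+1) k.
have [b /andP[b1 cb] bmax] :=
  @arg_maxnP _ (Ordinal k0K) (fun k => (1 < k)%N && (c k != 0)) F
    (introT andP (conj k01 ck0)).
apply/dense_snP => y q d d0.
(* With accuracy [d / (S + 1)] for each monomial, the total error is at most
   [S * (d / (S + 1)) < d]. *)
pose S := \sum_(k < K | (1 < k)%N) normc (c k).
have S0 : 0 <= S by apply: sumr_ge0 => k _; exact: normc_ge0.
have d'0 : 0 < d / (S + 1) by rewrite divr_gt0// ltr_wpDl.
have [N [Nb Nk]] := z_orbits K ((c b)^-1 *: y) q b1 d'0.
eexists; first by exists N.
rewrite linear_sum (bigD1 b)//= linearZ/= addrAC.
rewrite -[y in X in sn _ X](scale1r y) -[in X in sn _ X](mulfV cb) -scalerA -scalerBr.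
apply: (le_lt_trans (snD _ _ _)).
apply: (@le_lt_trans _ _ (S * (d / (S + 1)))); last first.
  by rewrite mulrCA gtr_pMr// ltr_pdivrMr ?ltr_wpDl// mul1r ltrDl.
have SE : S = normc (c b) + \sum_(k < K | (1 < k)%N && (k != b)) normc (c k).
  by rewrite /S (bigD1 b).
rewrite {1}SE mulrDl lerD//.
  by rewrite snZ ler_wpM2l ?normc_ge0// ltW.
rewrite mulr_suml (le_trans (sn_sum _ _ _ _))//.
apply: ler_sum => k /andP[k1 kb]; rewrite linearZ/= snZ.
have [->|ck] := eqVneq (c k) 0.
  by rewrite ComplexField.Normc.normc0 !mul0r.
rewrite ler_wpM2l ?normc_ge0// ltW// Nk// ?k1 ?ltn_ord//.
rewrite ltn_neqAle; apply/andP; split; last by apply: bmax; rewrite k1.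
apply: contra kb => /eqP/weight_inj h; apply/eqP/val_inj/h.
  by rewrite (ltnW k1) ltnW// ltnS ltn_ord.
by rewrite (ltnW b1) ltnW// ltnS ltn_ord.
Qed.

Lemma HC_neq0 x : (exists y : X, exists q, 0 < sn q y) -> HC T x -> x != 0.
Proof.
move=> [y [q y0]] /dense_snP/(_ y q _ y0)[_ [N _ <-]] xy.
apply: contraTneq xy => ->.
have -> : iter N T 0 = 0 by elim: N => //= N ->; rewrite linear0.
by rewrite sub0r snN ltxx.
Qed.

End HypercyclicSpan.

Theorem theorem1p3 (R : realType) (X : seqAlgebra R)
  (frechetX : is_frechet_seq_algebra X) (regularX : is_regular X)
  (w : nat -> R[i]) (w_neq0 : forall n, (1 <= n)%N -> w n != 0)
  (T : {linear X -> X}) (shiftT : is_bounded_weighted_shift w T) :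
  HC T !=set0 <->
  exists A : set X,
    [/\ is_hypercyclic_algebra T A, dense A & ~ finitely_generated A].
Proof.
split; last first.
  move=> [A [[[A0 _ _ _] Aneq0 AHC] _ _]].
  (* Without hypercyclic vectors the algebra would be reduced to 0. *)
  apply: contrapT => /set0P/negP; rewrite negbK => /eqP HC0.
  apply: Aneq0; apply/seteqP; split=> [x /AHC|_ ->//].
  by rewrite HC0 set0U.
move=> HC0; have [normX [e eE basis_e] supmulX] := regularX.
have [z [z_dense z_orbits]] :=
  exists_generators frechetX eE basis_e normX supmulX w_neq0 shiftT HC0.
have HCneq0 x : HC T x -> x != 0.
  apply: HC_neq0; have [q0 q0P] := sn_basis_gt0 eE normX.
  by exists (e 0%N), (q0 + 0)%N.
pose Q1 (k : nat) := (1 < k)%N.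
have Q1M k l : Q1 k -> Q1 l -> Q1 (k * l)%N.
  by rewrite /Q1 => k1 l1; rewrite (leq_trans k1)// leq_pmulr// ltnW.
pose A := mon_span z Q1.
have AHC : A `<=` HC T `|` [set 0].
  move=> _ [K [c ->]].
  have [[k /andP[k1 ck]]|c0] := pselect (exists k : 'I_K, (1 < k)%N && (c k != 0)).
    by left; apply: (HC_mon_sum z_orbits _ ck); rewrite k1 ltn_ord.
  right; apply: big1 => k k1; have [->|ck] := eqVneq (c k) 0; first exact: scale0r.
  by exfalso; apply: c0; exists k; rewrite ck andbT.
have zA p : prime p -> A (z p).
  by move=> pp; rewrite -(xmon_prime z pp); apply: mon_span_mon; exact: prime_gt1.
(* Algebraic independence: a polynomial with a nonzero coefficient gives a hypercyclic vector, which
   is not 0. *)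
have z_free K (c : nat -> R[i]) : \sum_(k < K | (1 < k)%N) c k *: xmon z k = 0 ->
    forall k, (1 < k < K)%N -> c k = 0.
  move=> c0 k k1; apply/eqP; apply: contraT => ck.
  by have := HCneq0 _ (HC_mon_sum z_orbits k1 ck); rewrite c0 eqxx.
have z_neq0 p : prime p -> z p != 0.
  move=> pp; apply/eqP => zp0.
  have : \sum_(k < p.+1 | (1 < k)%N) (k == p :> nat)%:R *: xmon z k = 0.
    rewrite (bigD1 (ord_max : 'I_p.+1)) ?prime_gt1//= eqxx scale1r xmon_prime//.
    rewrite zp0 add0r big1// => j /andP[_ jp].
    by rewrite (_ : (j == p :> nat) = false) ?scale0r//; exact: negbTE jp.
  move=> /(@z_free _ (fun j => (j == p)%:R))/(_ p).
  by rewrite prime_gt1//= ltnSn eqxx => /(_ isT)/eqP; rewrite oner_eq0.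
exists A; split.
- split => //.
    by apply: mon_span_subalgebra.
  move=> A0; have := zA 2%N isT; rewrite A0 => z20.
  by have := z_neq0 2%N isT; rewrite z20 eqxx.
- apply/dense_snP => x q d d0; have [p pp zp] := z_dense x q d d0.
  by exists (z p) => //; exact: zA.
- move=> [S /finite_seqP[s sS] AS].
  have SA : S `<=` A by rewrite AS; exact: sub_smallest.
  (* The finitely many generators only involve monomials of index below a common [K]. *)
  have [K KP] : exists K, forall x, x \in s -> exists c : nat -> R[i],
      x = \sum_(k < K | Q1 k) c k *: xmon z k.
    have : forall x, x \in s -> A x by move=> x xs; apply: SA; rewrite sS.
    elim: (s) => [|x s' IH] As; first by exists 0%N.
    have [|K KP] := IH; first by move=> y ys; apply: As; rewrite inE ys orbT.
    have [|L [c xE]] := As x; first by rewrite inE eqxx.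
    exists (maxn K L) => y; rewrite inE => /predU1P[->|/KP[c' ->]].
      exists (fun k => if (k < L)%N then c k else 0).
      by rewrite xE; apply: mon_sum_widen; exact: leq_maxr.
    exists (fun k => if (k < K)%N then c' k else 0).
    by apply: mon_sum_widen; exact: leq_maxl.
  (* A prime [P] above [K] divides none of these indices. The monomials without the variable [P]
     span a subalgebra, which therefore contains all of [A], in particular [z P]. *)
  have [P KlP Pp] := prime_above K.
  pose QP (k : nat) := (1 < k)%N && ~~ (P %| k)%N.
  have AQP : A `<=` mon_span z QP.
    rewrite AS; apply: smallest_sub.
      apply: mon_span_subalgebra => [k /andP[]//|k l /andP[k1 kP] /andP[l1 lP]].
      by apply/andP; split; [exact: Q1M|rewrite Euclid_dvdM// negb_or kP].
    move=> x; rewrite sS => /KP[c ->]; exists K, c; apply: eq_bigl => k.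
    rewrite /QP /Q1; case: ltnP => //= k1; apply/esym; apply/negP => /dvdn_leq.
    by rewrite (ltnW k1) leqNgt (ltn_trans (ltn_ord k) KlP) => /(_ isT).
  have [L [c zPE]] := AQP _ (zA P Pp).
  pose M := maxn L P.+1.
  (* The coefficients of [z P] minus its expansion in monomials without the variable [P]: the
     relation they give has coefficient 1 at [P], against independence. *)
  pose c' (k : nat) : R[i] := (k == P)%:R - (if (k < L)%N && ~~ (P %| k)%N then c k else 0).
  suff /(@z_free M c')/(_ P) : \sum_(k < M | (1 < k)%N) c' k *: xmon z k = 0.
    rewrite prime_gt1//= leq_max ltnSn orbT /c' eqxx dvdnn andbF subr0.
    by move=> /(_ isT)/eqP; rewrite oner_eq0.
  under eq_bigr do rewrite scalerBl.
  rewrite sumrB; apply/eqP; rewrite subr_eq0; apply/eqP.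
  have PM : (P < M)%N by rewrite leq_max ltnSn orbT.
  transitivity (z P).
    rewrite (bigD1 (Ordinal PM)) ?prime_gt1//= eqxx scale1r xmon_prime//.
    rewrite big1 ?addr0// => j /andP[_ jP].
    by rewrite (_ : (j == P :> nat) = false) ?scale0r//; exact: negbTE jP.
  rewrite zPE (mon_sum_widen _ _ _ (leq_maxl L P.+1)) /QP big_mkcondr.
  apply: eq_bigr => k _; case: (P %| k)%N; rewrite ?andbF ?scale0r ?andbT//.
Qed.
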